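(* For each positive integer $k$, the class of graphs having no vertex-minor isomorphic to the fan $F_k$ is $\chi$-bounded.
   Context: Graphs are finite and simple (no loops, no parallel edges). For a graph $G$, $\chi(G)$ is the chromatic number and $\omega(G)$ is the maximum size of a clique. A class $\mathcal{C}$ of graphs is $\chi$-bounded if there is a function $f:\mathbb{N}\to\mathbb{N}$ such that $\chi(H)\le f(\omega(H))$ for every $G\in\mathcal{C}$ and every induced subgraph $H$ of $G$. For a vertex $v$ of $G$ with neighborhood $N_G(v)$, local complementation at $v$ produces the graph $G*v$ obtained from $G$ by replacing the subgraph induced on $N_G(v)$ with its complement. A graph $H$ is a vertex-minor of $G$ if $H$ can be obtained from $G$ by a (possibly empty) sequence of local complementations and vertex deletions. The fan $F_k$ is the graph consisting of an induced path on $k$ vertices together with one additional vertex, not on the path, that is adjacent to all vertices of the path. *)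

(* Defs.v *)
From mathcomp Require Import all_boot.

Set Implicit Arguments.
Unset Strict Implicit.
Unset Printing Implicit Defensive.

Record sgraph := SGraph {
  vertex :> finType;
  edge : rel vertex;
  edge_sym : symmetric edge;
  edge_irrefl : irreflexive edge
}.

Definition isomorphic (G H : sgraph) : Prop :=
  exists2 f : G -> H, bijective f & forall x y, edge (f x) (f y) = edge x y.

Section Induced.
Variables (G : sgraph) (A : {set G}).

Definition induced_edge : rel {x : G | x \in A} :=
  fun x y => edge (val x) (val y).

Lemma induced_edge_sym : symmetric induced_edge.
Proof. by move=> x y; apply: edge_sym. Qed.

Lemma induced_edge_irrefl : irreflexive induced_edge.
Proof. by move=> x; apply: edge_irrefl. Qed.

Definition induced : sgraph := SGraph induced_edge_sym induced_edge_irrefl.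
End Induced.

Definition delete_vertex (G : sgraph) (v : G) : sgraph := induced [set~ v].

Section LocalComplement.
Variables (G : sgraph) (v : G).

(* [(+)] is exclusive or: adjacency is toggled exactly on the pairs of distinct
   neighbours of v. *)
Definition local_compl_edge : rel G :=
  fun x y => edge x y (+) [&& x != y, edge v x & edge v y].

Lemma local_compl_edge_sym : symmetric local_compl_edge.
Proof.
by move=> x y; rewrite /local_compl_edge edge_sym eq_sym [edge v x && _]andbC.
Qed.

Lemma local_compl_edge_irrefl : irreflexive local_compl_edge.
Proof. by move=> x; rewrite /local_compl_edge edge_irrefl eqxx. Qed.

Definition local_compl : sgraph :=
  SGraph local_compl_edge_sym local_compl_edge_irrefl.
End LocalComplement.

Inductive vertex_minor (G : sgraph) : sgraph -> Prop :=
| vertex_minor_refl : vertex_minor G G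
| vertex_minor_local_compl (H : sgraph) (v : H) :
    vertex_minor G H -> vertex_minor G (local_compl v)
| vertex_minor_delete (H : sgraph) (v : H) :
    vertex_minor G H -> vertex_minor G (delete_vertex v).

Section Fan.
Variable k : nat.

(* [None] is the hub; [Some i] is the i-th vertex of the path. *)
Definition fan_edge : rel (option 'I_k) := fun x y =>
  match x, y with
  | None, None => false
  | Some i, Some j => (i.+1 == j :> nat) || (j.+1 == i :> nat)
  | _, _ => true
  end.

Lemma fan_edge_sym : symmetric fan_edge.
Proof. by move=> [i|] [j|] //=; rewrite orbC. Qed.

Lemma fan_edge_irrefl : irreflexive fan_edge.
Proof. by move=> [i|] //=; rewrite orbb gtn_eqF. Qed.

Definition fan : sgraph := SGraph fan_edge_sym fan_edge_irrefl.
End Fan.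

Section Invariants.
Variable G : sgraph.

Definition clique (A : {set G}) : bool :=
  [forall x in A, forall y in A, (x != y) ==> edge x y].

Definition omega : nat := \max_(A : {set G} | clique A) #|A|.

Definition colorable (n : nat) : bool :=
  [exists c : {ffun G -> 'I_n}, forall x, forall y, edge x y ==> (c x != c y)].

Lemma colorable_card : colorable #|G|.
Proof.
apply/existsP; exists [ffun x => enum_rank x].
apply/forallP=> x; apply/forallP=> y; apply/implyP=> exy.
rewrite !ffunE (inj_eq enum_rank_inj).
by apply: contraTneq exy => ->; rewrite edge_irrefl.
Qed.

Lemma ex_colorable : exists n, colorable n.
Proof. by exists #|G|; apply: colorable_card. Qed.

Definition chi : nat := ex_minn ex_colorable.
End Invariants.

Definition chi_bounded (C : sgraph -> Prop) : Prop :=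
  exists f : nat -> nat, forall G : sgraph, C G ->
    forall A : {set G}, chi (induced A) <= f (omega (induced A)).

Definition fan_vertex_minor_free (k : nat) (G : sgraph) : Prop :=
  ~ exists2 H : sgraph, vertex_minor G H & isomorphic H (fan k).

(* Main.v *)
Require Import Defs.
From mathcomp Require Import all_boot.

Set Implicit Arguments.
Unset Strict Implicit.
Unset Printing Implicit Defensive.

(** Deleting a vertex commutes with local complementation at another vertex, so
    the vertex-minors of [G] are the induced subgraphs of the graphs obtained
    from [G] by local complementations. All constructions below therefore live
    on a fixed vertex set: only the adjacency relation changes, and deleting a
    vertex means ceasing to mention it.

    The proof is by induction on the clique number. If the neighbourhood of
    every vertex has bounded chromatic number while the whole graph does not,
    some distance level [i >= 2] of a connected induced subgraph has large
    chromatic number, and Gyarfas' argument ([gyarfas_path]) gives a long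
    induced path [P] in that level. Every vertex of [P] has a parent in level
    [i - 1]. If a parent has [k] neighbours on [P], smoothing its
    non-neighbours on [P] (a local complementation at [x] joins the two path
    neighbours of [x]) leaves a fan ([hub_fan_minor]).

    Otherwise [separated_blocks] selects many parents [v], together with
    disjoint consecutive blocks of [P], such that each [v] has neighbours on
    [P] only in its own block. By Ramsey's theorem the [v] may be taken
    independent. Each [v] has a parent [u] in level [i - 2]. Either some [u] is
    adjacent to many [v], or, again by Ramsey's theorem, the [u] may be taken
    private: [u] is adjacent to no other [v]. In the latter case the [u] lie in
    a connected set [H] formed by them and the levels below [i - 2]. A vertex
    of a connected graph can always be removed, after a local complementation
    at it if necessary, so that the rest stays connected ([conn_elim]); hence
    the graph on the [u] alone can be made connected. It then has a large
    star, a large clique or a long induced path, and in each case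
    ([star_hub], [clique_hub], [path_hub]) local complementations produce one
    hub adjacent to many of the [v] and to no vertex of [P].

    Finally, in each block the number of neighbours of [v] is lowered to one,
    after which a local complementation at [v] joins the hub to the block
    ([attach_block]); the hub and [P] then form a fan ([comb_fan_minor]). *)

(** * Local complementation, induced paths and fans *)

Section LC.
Variable T : finType.
Implicit Types (e : rel T) (s t xs P : seq T).

(** Adjacency relations of simple graphs. *)
Definition simple_rel e := symmetric e /\ irreflexive e.

(** Local complementation at [v], on a fixed vertex set. *)
Definition lcomp e (v : T) : rel T :=
  fun x y => e x y (+) [&& x != y, e v x & e v y].

(** Successive local complementations at the elements of [xs]. *)
Definition lcomps e xs := foldl lcomp e xs.

Lemma simple_rel_lcomp e v : simple_rel e -> simple_rel (lcomp e v).
Proof.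
move=> [se ie]; split=> [x y|x]; rewrite /lcomp ?eqxx ?ie //.
by rewrite se eq_sym [e v x && _]andbC.
Qed.

Lemma simple_rel_lcomps e xs : simple_rel e -> simple_rel (lcomps e xs).
Proof. by elim: xs e => //= x xs IH e /(simple_rel_lcomp x)/IH. Qed.

Lemma lcomps_cat e xs ys : lcomps e (xs ++ ys) = lcomps (lcomps e xs) ys.
Proof. exact: foldl_cat. Qed.

Lemma lcomp_idl e v x y : ~~ e v x -> lcomp e v x y = e x y.
Proof. by move=> /negbTE h; rewrite /lcomp h andbF addbF. Qed.

Lemma lcomp_idr e v x y : ~~ e v y -> lcomp e v x y = e x y.
Proof. by move=> /negbTE h; rewrite /lcomp h !andbF addbF. Qed.

(** [s] lists the vertices of an induced path in order: consecutive entries are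
    adjacent, no other pair is. Distinctness of the entries is not included. *)
Fixpoint induced_path e s : bool :=
  if s is x :: t then
    (if t is y :: t' then e x y && all (fun z => ~~ e x z) t' else true) && induced_path e t
  else true.

Lemma eq_induced_path e e' s :
  {in s &, e =2 e'} -> induced_path e s = induced_path e' s.
Proof.
elim: s => //= x s IH h; rewrite IH; last first.
  by move=> a b ha hb; rewrite h // inE ?ha ?hb orbT.
case: s h {IH} => //= y s h; rewrite h ?inE ?eqxx ?orbT //; congr (_ && _ && _).
by apply: eq_in_all => z hz; rewrite h // !inE ?eqxx ?hz ?orbT.
Qed.

Lemma induced_path_catr e s t : induced_path e (s ++ t) -> induced_path e t.
Proof. by elim: s => //= x s IH /andP[_ /IH]. Qed.

Lemma induced_path_catl e s t : induced_path e (s ++ t) -> induced_path e s.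
Proof.
elim: s => //= x s IH /andP[h /IH ->]; rewrite andbT.
by case: s h {IH} => //= y s /andP[-> ]; rewrite all_cat => /andP[->].
Qed.

Lemma induced_path_far e s z x t a :
  induced_path e (s ++ z :: x :: t) -> a \in s -> ~~ e a x.
Proof.
elim: s => //= b s IH /andP[h hp]; rewrite inE => /orP[/eqP->|]; last exact: IH.
case: s h {IH hp} => [|c s] /= /andP[_]; first by case/andP.
by rewrite all_cat /= => /and4P[].
Qed.

(** Smoothing: local complementation at a vertex [x] of an induced path makes its
    path neighbours adjacent, so that [x] can be dropped. *)
Lemma induced_path_smooth e s x t : simple_rel e -> uniq (s ++ x :: t) ->
  induced_path e (s ++ x :: t) -> induced_path (lcomp e x) (s ++ t).
Proof.
move=> [se ie]; elim: s => [|a s IH] /=.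
  move=> _ /andP[h ht]; rewrite -(@eq_induced_path e) //.
  case: t h ht => // y t /andP[_ /allP ht _] a b; rewrite !inE => ha hb.
  have [->|na] := eqVneq a b; first by rewrite /lcomp eqxx addbF.
  case/predU1P: ha => [ea|/ht na']; last by rewrite lcomp_idl.
  case/predU1P: hb => [eb|/ht nb']; last by rewrite lcomp_idr.
  by rewrite ea eb eqxx in na.
case/andP=> ha hu /andP[h hp]; rewrite IH // andbT {IH}.
case: s h ha hu hp => [|b s] /=.
  case: t => // y t /and3P[eax nay /allP hn] ha hu /andP[/andP[exy /allP hx] hp].
  move: ha hu; rewrite !inE !negb_or => /and3P[nax anay hat] _.
  rewrite /lcomp (negbTE nay) (se x a) eax exy anay /=.
  by apply/allP=> z hz; rewrite (negbTE (hx _ hz)) !andbF addbF hn.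
rewrite all_cat /= => /and4P[eab /allP h1 nax /allP h2] _ _ _.
have nxa : ~~ e x a by rewrite se.
rewrite lcomp_idl // eab /= all_cat; apply/andP; split; apply/allP=> z hz.
  by rewrite lcomp_idl // h1.
by rewrite lcomp_idl // h2.
Qed.

Lemma induced_path_nth e x0 s i j : induced_path e s -> i < j -> j < size s ->
  e (nth x0 s i) (nth x0 s j) = (i.+1 == j).
Proof.
elim: s i j => //= x s IH [|i] [|j] //= /andP[h hp] ij js; last by rewrite eqSS IH.
case: s h {IH hp} js => //= y s /andP[exy /allP h]; case: j ij => //= j _ js.
by apply/negbTE/h/mem_nth.
Qed.

(** An induced fan: hub [h] and path [p]. *)
Definition contains_fan k e := exists h p,
  [/\ size p = k, uniq (h :: p), induced_path e p & all (e h) p].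

(** Some graph locally equivalent to [e] has an induced fan, that is, [e] has a
    vertex-minor isomorphic to the fan. *)
Definition has_fan_minor k e := exists xs, contains_fan k (lcomps e xs).

Lemma has_fan_minor_lcomps k e xs : has_fan_minor k (lcomps e xs) -> has_fan_minor k e.
Proof. by move=> [ys h]; exists (xs ++ ys); rewrite lcomps_cat. Qed.

Lemma has_fan_minor_lcomp k e x : has_fan_minor k (lcomp e x) -> has_fan_minor k e.
Proof. exact: (@has_fan_minor_lcomps k e [:: x]). Qed.

Lemma hub_fan_minor k e h P : simple_rel e -> uniq (h :: P) -> induced_path e P ->
  k <= count (e h) P -> has_fan_minor k e.
Proof.
have [n] := ubnP (size P); elim: n e P => // n IH e P; rewrite ltnS => sP hsg hu hp hk.
have [hall|] := boolP (all (e h) P).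
  exists [::], h, (take k P); split.
  - by rewrite size_takel // (leq_trans hk) ?count_size.
  - have := hu; rewrite -{1}(cat_take_drop k P) -cat_cons cat_uniq.
    by case/and3P.
  - by move: hp; rewrite -{1}(cat_take_drop k P); apply: induced_path_catl.
  - by move: hall; rewrite -{1}(cat_take_drop k P) all_cat => /andP[].
case/allPn=> x xP nx; case/splitPr: xP sP hu hp hk => s t sP hu hp hk.
have nhx : ~~ e x h by rewrite hsg.1.
apply: (@has_fan_minor_lcomp _ _ x); apply: (IH _ (s ++ t)).
- by move: sP; rewrite !size_cat /= addnS.
- exact: simple_rel_lcomp.
- apply: subseq_uniq hu; rewrite /= eqxx; apply: cat_subseq => //.
  exact: subseq_cons.
- by apply: induced_path_smooth => //; case/andP: hu.
- rewrite (leq_trans hk) // !count_cat /= (negbTE nx) add0n.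
  by rewrite !(@eq_count _ (lcomp e x h) (e h)) // => z; rewrite lcomp_idl.
Qed.

End LC.

(** * From a hub attached to blocks of a path to a fan *)

Section Comb.
Variable T : finType.
Implicit Types (e : rel T) (s t xs P : seq T).

(** On the path, only [z] and [y] are adjacent to [x]. *)
Lemma induced_path_mid e s z x y t a : simple_rel e ->
  induced_path e (s ++ [:: z, x, y & t]) ->
  a \in s ++ t -> ~~ e x a.
Proof.
move=> [se _] hp; rewrite mem_cat => /orP[ha|ha].
  by rewrite se; exact: induced_path_far hp ha.
by move/induced_path_catr: hp => /= /and3P[_ /andP[_ /allP h] _]; exact: h.
Qed.

(** The path is [s1 ++ I ++ s2], and [v], a neighbour of the hub [h], has
    neighbours on it only in the block [I]. Local complementations at vertices
    of [I] and at [v] shrink [I] to a block that contains a neighbour of [h].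
    The condition on [find] says that [I] starts with enough non-neighbours of
    [v]: each of them serves once to lower the number of neighbours of [v].
    The last clause keeps intact the rows of vertices away from [v] and [I]. *)
Lemma attach_block e v h s1 I s2 : simple_rel e ->
  uniq (s1 ++ I ++ s2) -> induced_path e (s1 ++ I ++ s2) ->
  h \notin s1 ++ I ++ s2 -> v \notin s1 ++ I ++ s2 ->
  {in I, forall x, ~~ e h x} -> {in s1 ++ s2, forall x, ~~ e v x} ->
  e h v -> has (e v) I -> count (e v) I <= (find (e v) I).+1 ->
  exists xs I', [/\ subseq I' I, induced_path (lcomps e xs) (s1 ++ I' ++ s2),
    has (lcomps e xs h) I', {in s1 ++ s2, forall x, lcomps e xs h x = e h x} &
    forall y, ~~ e v y -> {in I, forall x, ~~ e y x} ->
      forall z, lcomps e xs y z = e y z].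
Proof.
have [n] := ubnP (size I); elim: n e I => // n IH e I; rewrite ltnS => sI hsg.
have [se ie] := hsg.
move=> hu hp hh hv hI h12 ehv vI cI.
(* Induction step: local complementation at a vertex [x] of the block, which
   is dropped. *)
have rec x I' : x \in I -> (v \notin [:: x]) -> subseq I' I -> size I' < size I ->
    induced_path (lcomp e x) (s1 ++ I' ++ s2) ->
    {in s1 ++ s2, forall a, lcomp e x v a = e v a} ->
    has (lcomp e x v) I' -> count (lcomp e x v) I' <= (find (lcomp e x v) I').+1 ->
  exists xs I', [/\ subseq I' I, induced_path (lcomps e xs) (s1 ++ I' ++ s2),
    has (lcomps e xs h) I', {in s1 ++ s2, forall x, lcomps e xs h x = e h x} &
    forall y, ~~ e v y -> {in I, forall x, ~~ e y x} ->
      forall z, lcomps e xs y z = e y z].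
  move=> xI vx sub sz hp' ha hhas hc.
  have nxh : ~~ e x h by rewrite se hI.
  have sub2 : subseq (s1 ++ I' ++ s2) (s1 ++ I ++ s2).
    by rewrite !cat_subseq.
  have [|||||||||||xs [J [h1 h2 h3 h4 h5]]] := IH (lcomp e x) I'.
  - exact: leq_trans sz sI.
  - exact: simple_rel_lcomp.
  - exact: subseq_uniq hu.
  - by [].
  - by apply: contraNN hh; apply: mem_subseq.
  - by apply: contraNN hv; apply: mem_subseq.
  - by move=> a /(mem_subseq sub)/hI; rewrite lcomp_idl.
  - by move=> a aI; rewrite ha // h12.
  - by rewrite lcomp_idl.
  - by [].
  - by [].
  exists (x :: xs), J; split=> //.
  - exact: subseq_trans h1 sub.
  - by move=> a aI; rewrite /= h4 // lcomp_idl.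
  - move=> y vy yI z; have nxy : ~~ e x y by rewrite se yI.
    rewrite /= h5 //; first by rewrite lcomp_idl.
    + by rewrite lcomp_idr.
    + by move=> a /(mem_subseq sub)/yI; rewrite lcomp_idl.
(* A single neighbour [p] of [v]: local complementation at [v] only toggles
   the pair of [h] and [p]. *)
have [c1|c2] := leqP (count (e v) I) 1.
  have cc : count (e v) I = 1 by apply/eqP; rewrite eqn_leq c1 -has_count.
  exists [:: v], I; split=> //=.
  - rewrite -(@eq_induced_path _ e) // => a b ha hb; rewrite /lcomp.
    have [->|nab] /= := eqVneq a b; first by rewrite addbF.
    case va: (e v a); last by rewrite addbF.
    case vb: (e v b); last by rewrite addbF.
    have mI z : z \in s1 ++ I ++ s2 -> e v z -> z \in I.
      rewrite !mem_cat orbCA => /orP[//|zz].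
      by rewrite (negbTE (h12 z _)) // mem_cat.
    have aI := mI _ ha va; have bI := mI _ hb vb.
    have uI : uniq (filter (e v) I).
      by apply: filter_uniq; move: hu; rewrite !cat_uniq => /and3P[_ _ /and3P[]].
    have : size [:: a; b] <= size (filter (e v) I).
      apply: uniq_leq_size; first by rewrite /= inE nab.
      by move=> z; rewrite !inE mem_filter => /orP[]/eqP->; rewrite ?va ?vb.
    by rewrite size_filter cc.
  - case/hasP: vI => p pI vp; apply/hasP; exists p => //.
    rewrite /lcomp (negbTE (hI p pI)) se ehv vp /= andbT.
    by apply: contraNneq hh => ->; rewrite !mem_cat pI !orbT.
  - by move=> a /h12 va; rewrite lcomp_idr.
  - by move=> y vy _ z; rewrite lcomp_idl.
(* The first neighbour [x] of [v] in the block. *)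
have [x Ix] : exists2 x, e v x & exists Z J, I = Z ++ x :: J /\ ~~ has (e v) Z.
  exists (nth v I (find (e v) I)); first exact: nth_find.
  exists (take (find (e v) I) I), (drop (find (e v) I).+1 I); split.
    by rewrite -drop_nth -?has_find ?cat_take_drop.
  by rewrite has_find -has_find // has_take // ltnn.
case=> Z [J [EI nZ]].
have fI : find (e v) I = size Z by rewrite EI find_cat (negbTE nZ) /= Ix addn0.
have cZ : count (e v) Z = 0 by apply/eqP; rewrite -leqn0 leqNgt -has_count.
have cJ : 0 < count (e v) J <= size Z.
  move: c2 cI; rewrite fI EI count_cat cZ /= Ix add0n add1n !ltnS.
  by move=> -> ->.
case: J EI cJ => [//|y J] EI cJ.
(* A non-neighbour [y] after the first neighbour is smoothed. *)
have [vy|nvy] := boolP (e v y); last first.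
  have nyv : ~~ e y v by rewrite se.
  have vE : lcomp e y v =1 e v by move=> z; rewrite lcomp_idl.
  apply: (rec y (Z ++ x :: J)).
  - by rewrite EI !mem_cat !inE eqxx !orbT.
  - by apply: contraNN hv; rewrite inE => /eqP->; rewrite EI !mem_cat !inE eqxx !orbT.
  - rewrite EI; apply: cat_subseq => //; rewrite /= eqxx; exact: subseq_cons.
  - by rewrite EI !size_cat /= !addnS.
  - move: hu hp; rewrite EI.
    have -> : s1 ++ (Z ++ [:: x, y & J]) ++ s2 = (s1 ++ Z ++ [:: x]) ++ y :: (J ++ s2).
      by rewrite -!catA.
    move=> hu hp; have := induced_path_smooth hsg hu hp; by rewrite -!catA.
  - by move=> a _; rewrite vE.
  - by rewrite (eq_has vE) has_cat /= Ix orbT.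
  - rewrite (eq_count vE) (eq_find vE) count_cat cZ /= Ix find_cat (negbTE nZ) /= Ix.
    by move: cJ => /=; rewrite (negbTE nvy) add0n addn0 add1n ltnS => /andP[].
(* Otherwise [z], [x], [y] are consecutive and [v] is adjacent to [x] and [y]
   but not to [z]: local complementation at [x] makes it adjacent to [z] and
   no longer to [y]. *)
case/lastP: Z EI nZ fI cZ cJ => [|Z z] EI nZ fI cZ cJ.
  by move: cJ => /=; rewrite leqn0 lt0n => /andP[/negbTE->].
have vz : ~~ e v z by move: nZ; rewrite has_rcons negb_or => /andP[].
have {nZ} nZ : ~~ has (e v) Z by move: nZ; rewrite has_rcons negb_or => /andP[].
have EI' : I = Z ++ [:: z, x, y & J] by rewrite EI -cats1 -catA.
have hp2 : induced_path e ((s1 ++ Z) ++ [:: z, x, y & (J ++ s2)]).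
  by move: hp; rewrite EI' -!catA.
have far a : a \in (s1 ++ Z) ++ (J ++ s2) -> ~~ e x a.
  by move=> ha; apply: (induced_path_mid hsg hp2).
have [exz exy] : e x z /\ e x y.
  by move/induced_path_catr: hp2 => /=; rewrite (se x z) => /and4P[/andP[-> _] /andP[-> _]].
have nvz : v != z.
  by apply: contraNneq hv => ->; rewrite EI' !mem_cat !inE eqxx !orbT.
have nvy : v != y.
  by apply: contraNneq hv => ->; rewrite EI' !mem_cat !inE eqxx !orbT.
have exv : e x v by rewrite se.
have lz : lcomp e x v z by rewrite /lcomp (negbTE vz) nvz exv exz.
have ly : lcomp e x v y = false by rewrite /lcomp vy nvy exv exy.
have lZ : ~~ has (lcomp e x v) Z.
  apply/hasPn=> a aZ; rewrite lcomp_idr ?(hasPn nZ) //.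
  by apply: far; rewrite !mem_cat aZ orbT.
have lJ : count (lcomp e x v) J = count (e v) J.
  apply: eq_in_count => a aJ; rewrite lcomp_idr //.
  by apply: far; rewrite !mem_cat aJ !orbT.
apply: (rec x (Z ++ [:: z, y & J])).
- by rewrite EI' !mem_cat !inE eqxx !orbT.
- by apply: contraNN hv; rewrite inE => /eqP->; rewrite EI' !mem_cat !inE eqxx !orbT.
- rewrite EI'; apply: cat_subseq => //; have := subseq_cons (y :: J) x.
  by rewrite [subseq (z :: _) _]/= eqxx.
- by rewrite EI' !size_cat /= !addnS.
- have eqL : s1 ++ I ++ s2 = (s1 ++ Z ++ [:: z]) ++ x :: (y :: J ++ s2).
    by rewrite EI' -!catA.
  by rewrite eqL in hu hp; have := induced_path_smooth hsg hu hp; rewrite -!catA.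
- move=> a aI; rewrite lcomp_idr //; apply: far; move: aI.
  by rewrite !mem_cat => /orP[]->; rewrite ?orbT.
- by rewrite has_cat /= lz orbT.
- have cz0 : count (lcomp e x v) Z = 0.
    by apply/eqP; rewrite -leqn0 leqNgt -has_count.
  rewrite count_cat find_cat (negbTE lZ) cz0 /= lz ly add0n addn0 lJ.
  by move: cJ => /=; rewrite vy size_rcons !add1n ltnS => /andP[_]; rewrite ltnS.
Qed.

(** [F] lists pairs of a vertex [v] and a block, the path being the prefix [s1]
    followed by the blocks. Only the vertices selected by [act] are attached to
    the hub [h]. The blocks are treated one by one and moved into [s1], where
    the neighbours of [h] accumulate. *)
Lemma comb_fan_minor k (F : seq (T * seq T)) e s1 h (act : pred T) : simple_rel e ->
  let P := s1 ++ flatten (unzip2 F) in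
  uniq P -> induced_path e P -> h \notin P ->
  {in flatten (unzip2 F), forall x, ~~ e h x} ->
  {in F, forall c, act c.1 -> [/\ e h c.1, c.1 \notin P,
      {in s1, forall x, ~~ e c.1 x}, has (e c.1) c.2 &
      count (e c.1) c.2 <= (find (e c.1) c.2).+1]} ->
  {in F &, forall c c', act c.1 -> act c'.1 -> ~~ e c.1 c'.1} ->
  pairwise (fun c c' => (act c.1 ==> ~~ has (e c.1) c'.2)
                     && (act c'.1 ==> ~~ has (e c'.1) c.2)) F ->
  k <= count (e h) s1 + count (fun c => act c.1) F ->
  has_fan_minor k e.
Proof.
elim: F e s1 => [|[v I] F IH] e s1 hsg /=.
  by rewrite cats0 addn0 => hu hp hh _ _ _ _; apply: hub_fan_minor => //=; rewrite hh.
have [se ie] := hsg.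
set s2 := flatten _ => hu hp hh hI hF hind /andP[/allP hpw1 hpw] hk.
have [av|nav] := boolP (act v); last first.
  apply: (IH e (s1 ++ I)); rewrite -?catA //.
  - by move=> x xF; rewrite hI // mem_cat xF orbT.
  - move=> c cF ac; have [|h1 h2 h3 h4 h5] := hF c _ ac; first by rewrite inE cF orbT.
    split=> // x; rewrite mem_cat => /orP[|xI]; first exact: h3.
    have /andP[_] := hpw1 _ cF; rewrite ac /= => /hasPn; exact.
  - by move=> c c' cF cF'; apply: hind; rewrite inE ?cF ?cF' orbT.
  - apply: leq_trans hk _; rewrite count_cat (negbTE nav) add0n.
    by rewrite leq_add2r leq_addr.
have [|/= h1 h2 h3 h4 h5] := hF (v, I) _ av; first by rewrite inE eqxx.
have h12 : {in s1 ++ s2, forall x, ~~ e v x}.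
  move=> x; rewrite mem_cat => /orP[|]; first exact: h3.
  case/flattenP=> B /mapP[c cF ->] xB.
  by have := hpw1 _ cF; rewrite /= av /= => /andP[/hasPn + _]; apply.
have hI1 : {in I, forall x, ~~ e h x} by move=> x xI; rewrite hI // mem_cat xI.
have [xs [I' [i1 i2 i3 i4 i5]]] := attach_block hsg hu hp hh h2 hI1 h12 h1 h4 h5.
have sub2 : subseq (s1 ++ I' ++ s2) (s1 ++ I ++ s2) by rewrite !cat_subseq.
have eqF c : c \in F -> act c.1 -> forall z, lcomps e xs c.1 z = e c.1 z.
  move=> cF ac; apply: i5.
    by apply: (hind (v, I) c) => //; rewrite inE ?eqxx ?cF ?orbT.
  have /andP[_] := hpw1 _ cF; rewrite ac /= => /hasPn; exact.
have seq' := simple_rel_lcomps xs hsg.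
apply: (@has_fan_minor_lcomps _ _ _ xs).
apply: (IH _ (s1 ++ I')) => //; rewrite -?catA //.
- exact: subseq_uniq hu.
- by apply: contraNN hh; apply: mem_subseq.
- by move=> x xF; rewrite i4 ?mem_cat ?xF ?orbT // hI // mem_cat xF orbT.
- move=> c cF ac; have [|j1 j2 j3 j4 j5] := hF c _ ac; first by rewrite inE cF orbT.
  have eqc := eqF c cF ac; rewrite (eq_has eqc) (eq_count eqc) (eq_find eqc); split=> //.
  + by rewrite seq'.1 eqc se.
  + by apply: contraNN j2; apply: mem_subseq.
  + move=> x; rewrite mem_cat eqc => /orP[|/(mem_subseq i1) xI]; first exact: j3.
    have /andP[_] := hpw1 _ cF; rewrite ac /= => /hasPn; exact.
- move=> c c' cF cF' ac ac'; rewrite eqF // hind // inE ?cF ?cF' orbT //.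
- apply: (sub_in_pairwise _ (allss F) hpw) => c c' cF cF' /andP[p1 p2]; apply/andP; split.
    by apply/implyP=> ac; rewrite (eq_has (eqF c cF ac)) (implyP p1).
  by apply/implyP=> ac; rewrite (eq_has (eqF c' cF' ac)) (implyP p2).
- apply: leq_trans hk _; rewrite av count_cat addnA leq_add2r.
  have -> : count (lcomps e xs h) s1 = count (e h) s1.
    by apply: eq_in_count => x x1; rewrite i4 // mem_cat x1.
  by rewrite leq_add2l -has_count.
Qed.

End Comb.

(** * Ramsey and selection arguments on sequences *)

(** Ramsey's theorem for ordered pairs of a sequence. Here and below the bound is
    given by a sigma type, so that the final bounding function of the clique
    number is obtained without a choice principle. *)
Lemma ramsey_seq a b : {N | forall (X : eqType) (R : rel X) (s : seq X),
  N <= size s ->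
  (exists t, [/\ subseq t s, size t = a & pairwise R t]) \/
  (exists t, [/\ subseq t s, size t = b & pairwise (fun x y => ~~ R x y) t])}.
Proof.
elim: a b => [|a IHa] b.
  by exists 0 => X R s _; left; exists [::]; rewrite sub0seq.
elim: b => [|b [N2 IHb]].
  by exists 0 => X R s _; right; exists [::]; rewrite sub0seq.
have [N1 IH1] := IHa b.+1.
exists (N1 + N2).+1 => X R [//|x s] /=; rewrite ltnS => hs.
have [h1|h1] := leqP N1 (count (R x) s).
  have [|[t [t1 t2 t3]]|[t [t1 t2 t3]]] := IH1 X R (filter (R x) s).
  - by rewrite size_filter.
  - left; exists (x :: t); split.
    + by rewrite /= eqxx (subseq_trans t1) ?filter_subseq.
    + by rewrite /= t2.
    + rewrite /= t3 andbT; apply/allP=> z /(mem_subseq t1).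
      by rewrite mem_filter => /andP[].
  - right; exists t; split=> //.
    apply: subseq_trans (subseq_cons _ _).
    by rewrite (subseq_trans t1) ?filter_subseq.
have [|[t [t1 t2 t3]]|[t [t1 t2 t3]]] := IHb X R (filter (predC (R x)) s).
- rewrite size_filter; move: hs; rewrite -(count_predC (R x)).
  by move=> /(leq_trans _) h; rewrite -(leq_add2l (count (R x) s)) h // leq_add2r ltnW.
- left; exists t; split=> //.
  apply: subseq_trans (subseq_cons _ _).
  by rewrite (subseq_trans t1) ?filter_subseq.
- right; exists (x :: t); split.
  + by rewrite /= eqxx (subseq_trans t1) ?filter_subseq.
  + by rewrite /= t2.
  + rewrite /= t3 andbT; apply/allP=> z /(mem_subseq t1).
    by rewrite mem_filter => /andP[].
Qed.

(** A long sequence with at most [k] elements satisfying [P] has a long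
    contiguous part without such elements. *)
Lemma long_gap (X : Type) (P : pred X) n k (l : seq X) :
  n * k.+1 <= size l -> count P l <= k ->
  exists a W b, [/\ l = a ++ W ++ b, n <= size W & ~~ has P W].
Proof.
elim: k l => [|k IH] l hs hc.
  exists [::], l, [::]; rewrite cats0 has_count -leqNgt; split=> //.
  by rewrite muln1 in hs.
have [hP|hP] := boolP (has P (take n l)); last first.
  exists [::], (take n l), (drop n l); rewrite cat_take_drop; split=> //.
  by rewrite size_takel // (leq_trans _ hs) // leq_pmulr.
have [||a [W [b [E hW nW]]]] := IH (drop n l).
- have nl : n <= size l by apply: leq_trans hs; rewrite leq_pmulr.
  by rewrite size_drop leq_subRL // -mulnS.
- rewrite -ltnS; apply: leq_trans hc.
  by rewrite -{2}(cat_take_drop n l) count_cat -add1n leq_add2r -has_count.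
by exists (take n l ++ a), W, b; rewrite -catA -E cat_take_drop.
Qed.

(** A marked item [y], followed by two sequences of items. *)
Definition marked_block (X : Type) (c : X * seq X * seq X) := c.1.1 :: c.1.2 ++ c.2.

(** If every item hits at most [k] items of a long sequence, then a contiguous
    part of the sequence splits into [m] blocks whose first items hit nothing
    in the later blocks, nor in the last [g] items of their own block. *)
Lemma spread_blocks k g m : {N | forall (X : eqType) (hit : rel X) (l : seq X),
  N <= size l -> {in l, forall y, count (hit y) l <= k} ->
  exists pre cs post,
    [/\ l = pre ++ flatten (map (@marked_block X) cs) ++ post, size cs = m,
      {in cs, forall c, g <= size c.2 /\ ~~ has (hit c.1.1) c.2} &
      pairwise (fun c c' => ~~ has (hit c.1.1) (marked_block c')) cs]}.
Proof.
elim: m => [|m [N IH]].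
  by exists 0 => X hit l _ _; exists [::], [::], l.
exists ((g + N) * k.+1).+1 => X hit [//|y l] /=; rewrite ltnS => hs hc.
have hcy : count (hit y) l <= k.
  by apply: leq_trans (hc y (mem_head _ _)); rewrite leq_addl.
have [a [W [b [E sW nW]]]] := long_gap hs hcy.
have {sW} [Z0 [W' [EW sZ sW]]] : exists Z0 W', [/\ W = Z0 ++ W', size Z0 = g & N <= size W'].
  exists (take g W), (drop g W); rewrite cat_take_drop size_takel.
    by rewrite size_drop leq_subRL // (leq_trans _ sW) // leq_addr.
  by rewrite (leq_trans _ sW) // leq_addr.
subst W l.
have [||pre [cs [post [E1 E2 E3 E4]]]] := IH X hit W'.
- by [].
- move=> z zW; have zl : z \in y :: a ++ (Z0 ++ W') ++ b.
    by rewrite !(inE, mem_cat) zW !orbT.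
  apply: leq_trans (hc z zl); apply: (@leq_count_subseq _ (hit z) _ (y :: _)).
  apply: subseq_trans (subseq_cons _ y).
  apply: subseq_trans (suffix_subseq _ _); apply: subseq_trans (prefix_subseq _ _).
  exact: suffix_subseq.
exists [::], ((y, a, Z0 ++ pre) :: cs), (post ++ b); split=> /=.
- by rewrite E1 /marked_block /= -!catA.
- by rewrite E2.
- move=> c; rewrite inE => /orP[/eqP->|/E3//] /=; split.
    by rewrite size_cat sZ leq_addr.
  by apply: contraNN nW; rewrite E1 !has_cat => /orP[->|->] //; rewrite !orbT.
- rewrite E4 andbT; apply/allP=> c cc; apply: contraNN nW => hb.
  have [z zc hz] : exists2 z, z \in marked_block c & hit y z by apply/hasP.
  apply/hasP; exists z => //; rewrite E1 !mem_cat.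
  by rewrite [z \in flatten _](_ : _ = true) ?orbT //; apply/flatten_mapP; exists c.
Qed.

(** * Disjoint blocks of a path *)

Lemma has_flatten (X : Type) (p : pred X) ss : has p (flatten ss) = has (has p) ss.
Proof. by elim: ss => //= s ss IH; rewrite has_cat IH. Qed.

Lemma count_has_flatten (X : Type) (p : pred X) ss :
  count (has p) ss <= count p (flatten ss).
Proof. by elim: ss => //= s ss IH; rewrite count_cat leq_add // has_count; case: count. Qed.

Lemma pairwise_rev (X : Type) (r : rel X) s :
  pairwise r (rev s) = pairwise (fun x y => r y x) s.
Proof. by elim: s => //= x s IH; rewrite rev_cons pairwise_rcons IH all_rev. Qed.

Lemma pairwise_flatten (X : Type) (r : rel X) ss :
  pairwise r (flatten ss) -> pairwise (allrel r) ss.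
Proof.
elim: ss => //= s ss IH; rewrite pairwise_cat => /and3P[h _ /IH ->]; rewrite andbT.
by elim: ss h {IH} => //= t ss IH; rewrite allrel_catr => /andP[-> /IH].
Qed.

Lemma flatten_flatten (X Y : Type) (f : Y -> seq (seq X)) s :
  flatten (flatten (map f s)) = flatten (map (fun y => flatten (f y)) s).
Proof. by elim: s => //= y s <-; rewrite flatten_cat. Qed.

Lemma size_flatten_ge (X : Type) (ss : seq (seq X)) :
  all (fun s => 0 < size s) ss -> size ss <= size (flatten ss).
Proof.
elim: ss => //= s ss IH /andP[h /IH h']; rewrite size_cat.
by rewrite -add1n leq_add.
Qed.

Lemma subseq_flatten (X : eqType) (s : seq X) ss : s \in ss -> subseq s (flatten ss).
Proof.
case/splitPr=> s1 s2; rewrite flatten_cat /=; apply: subseq_trans (suffix_subseq _ _).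
exact: prefix_subseq.
Qed.

(** [spread_blocks] is used twice: along [P], so that the parent of the head of a block
    has no neighbours in the later blocks, and then along the reversed
    sequence of these blocks, so that it has none in the earlier ones either.
    The second time, the reserved [k] items give each block a prefix free of
    neighbours of its vertex. *)
Lemma separated_blocks k m : {N | forall (T : eqType) (e : rel T) (par : T -> T) P,
  N <= size P -> {in P, forall x, e (par x) x} ->
  {in P, forall x, count (e (par x)) P <= k} ->
  exists pre (F : seq (T * seq T)) post,
  [/\ P = pre ++ flatten (unzip2 F) ++ post, size F = m,
    {in F, forall c, [/\ exists2 x, x \in P & c.1 = par x, has (e c.1) c.2 &
                      count (e c.1) c.2 <= (find (e c.1) c.2).+1]} &
    pairwise (fun c c' => ~~ has (e c.1) c'.2 && ~~ has (e c'.1) c.2) F]}.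
Proof.
have [N2 sp2] := spread_blocks k k m; have [N1 sp1] := spread_blocks k 0 N2.
exists N1.+1 => T e par [//|x0 P']; set P := x0 :: P' => sP hpar hcnt.
have [pre1 [cs1 [post1 [E1 s1 _ pw1]]]] :=
  sp1 T (fun x y => e (par x) y) P (ltnW sP) hcnt.
set bs := map (@marked_block _) cs1 in E1.
pose hd := head x0; pose hit b b' := has (e (par (hd b))) b'.
have bsP b : b \in bs -> {subset b <= P}.
  move=> bb x xb; rewrite E1 !mem_cat [x \in flatten _](_ : _ = true) ?orbT //.
  by apply/flattenP; exists b.
have hdb b : b \in bs -> hd b \in b by case/mapP=> c _ ->; rewrite /hd inE eqxx.
have ndb b : b \in bs -> 0 < size b by case/mapP=> c _ ->.
have cntP y s : y \in P -> subseq s P -> count (e (par y)) s <= k.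
  by move=> yP sub; apply: leq_trans (hcnt y yP); apply: leq_count_subseq.
have pwb : pairwise (fun b b' => ~~ hit b b') bs by rewrite pairwise_map.
have [||pre2 [cs2 [post2 [E2 s2 h2 pw2]]]] := sp2 (seq T) hit (rev bs).
- by rewrite size_rev size_map s1.
- move=> b; rewrite mem_rev => bb; rewrite count_rev.
  apply: leq_trans (count_has_flatten _ _) _; apply: cntP; first exact: (bsP b _ _ (hdb b bb)).
  rewrite E1; apply: subseq_trans (suffix_subseq _ _); exact: prefix_subseq.
have bsc c : c \in cs2 -> {subset marked_block c <= bs}.
  move=> cc b bc; rewrite -mem_rev E2 !mem_cat.
  by rewrite [b \in flatten _](_ : _ = true) ?orbT //; apply/flatten_mapP; exists c.
pose g (c : seq T * seq (seq T) * seq (seq T)) :=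
  (par (hd c.1.1), flatten (rev (marked_block c))).
have Ebs : flatten bs = flatten (rev post2) ++
    flatten (unzip2 (rev (map g cs2))) ++ flatten (rev pre2).
  rewrite -[bs]revK E2 !rev_cat !flatten_cat -catA rev_flatten -map_comp -map_rev.
  by rewrite flatten_flatten /unzip2 -map_rev -map_comp.
exists (pre1 ++ flatten (rev post2)), (rev (map g cs2)), (flatten (rev pre2) ++ post1).
split.
- by rewrite E1 Ebs -!catA.
- by rewrite size_rev size_map.
- move=> c; rewrite mem_rev => /mapP[[[b a] Z] cc ->] /=.
  have bb : b \in bs by apply: (bsc _ cc); rewrite inE eqxx.
  have bP := bsP b bb _ (hdb b bb).
  have [kZ nZ] := h2 _ cc.
  split; first by exists (hd b).
    apply/hasP; exists (hd b); last exact: hpar.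
    by apply/flattenP; exists b; rewrite ?mem_rev ?inE ?eqxx ?hdb.
  apply: (@leq_trans k).
    apply: cntP => //; rewrite E1 Ebs.
    apply: subseq_trans (suffix_subseq _ _); apply: subseq_trans (prefix_subseq _ _).
    apply: subseq_trans (suffix_subseq _ _); apply: subseq_trans (prefix_subseq _ _).
    apply: subseq_flatten; apply/mapP; exists (g (b, a, Z)) => //.
    by rewrite mem_rev map_f.
  rewrite /marked_block /= rev_cons rev_cat -cats1 -catA flatten_cat find_cat.
  rewrite has_flatten has_rev (negbTE nZ).
  apply: leqW; apply: leq_trans (leq_addr _ _); apply: leq_trans kZ _.
  rewrite -size_rev; apply: size_flatten_ge; rewrite all_rev; apply/allP=> z zZ.
  by apply: ndb; apply: (bsc _ cc); rewrite /marked_block inE mem_cat zZ !orbT.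
rewrite pairwise_rev pairwise_map.
have : pairwise (fun b b' => ~~ hit b' b) (rev bs) by rewrite pairwise_rev.
rewrite E2 !pairwise_cat => /and5P[_ _ _ /pairwise_flatten + _].
rewrite pairwise_map => pw3.
have := conj pw2 pw3 => /andP; rewrite -pairwise_relI.
apply: sub_pairwise => c c' /= /andP[p1 p2]; apply/andP; split.
  rewrite has_flatten has_rev; apply/hasPn=> b bc.
  by apply: (allrelP p2); rewrite // inE eqxx.
by rewrite has_flatten has_rev.
Qed.

(** * Creating a hub by local complementation *)

Section Hub.
Variable T : finType.
Implicit Types (e : rel T) (s t xs D S Z : seq T) (u : T -> T).

(** After local complementations some vertex [h] outside [Z], with no neighbours
    in [Z], is adjacent to at least [m] elements [S] of [s], while adjacency
    among [S] and [Z] is as in [e]. Here [Z] is the set of vertices of the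
    path, and [s] lists vertices attached to it. *)
Definition hub_reachable m e s Z := exists xs h S,
  [/\ [/\ uniq S, {subset S <= s} & m <= size S],
      {in S, forall v, lcomps e xs h v}, h \notin Z,
      {in Z, forall z, ~~ lcomps e xs h z} & {in S ++ Z &, lcomps e xs =2 e}].

Lemma hub_reachable_sub m e s s' Z :
  {subset s' <= s} -> hub_reachable m e s' Z -> hub_reachable m e s Z.
Proof.
move=> sub [xs [h [S [[h1 h2 h3] h4 h5 h6 h7]]]]; exists xs, h, S; split=> //.
by split=> // x /h2/sub.
Qed.

Lemma hub_reachable_lcomps m e xs s Z : {in s ++ Z &, lcomps e xs =2 e} ->
  hub_reachable m (lcomps e xs) s Z -> hub_reachable m e s Z.
Proof.
move=> ag [ys [h [S [[h1 h2 h3] h4 h5 h6 h7]]]].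
exists (xs ++ ys), h, S; rewrite lcomps_cat; split=> // x y xS yS.
have sub : {subset S ++ Z <= s ++ Z}.
  by move=> z; rewrite !mem_cat => /orP[/h2|] ->; rewrite ?orbT.
by rewrite h7 // ag //; apply: sub.
Qed.

Lemma hub_reachable_direct m e h s Z : uniq s -> m <= size s -> {in s, forall v, e h v} ->
  h \notin Z -> {in Z, forall z, ~~ e h z} -> hub_reachable m e s Z.
Proof. by move=> *; exists [::], h, s; split; first split. Qed.

(** Local complementation at a vertex with at most one neighbour in [A] changes
    nothing inside [A]. *)
Lemma lcomp_agree e w b (A : seq T) : {in A, forall x, e w x -> x = b} ->
  {in A &, lcomp e w =2 e}.
Proof.
move=> h x y xA yA; rewrite /lcomp.
case wx: (e w x); last by rewrite andbF addbF.
case wy: (e w y); last by rewrite !andbF addbF.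
by rewrite (h x) // (h y) // eqxx addbF.
Qed.

(** The hub [q] is adjacent to the independent vertices [u b], each of which has
    the private neighbour [b]. Local complementation at [u b] joins [q] to [b].
    The sequence [D] collects the vertices already joined to [q]. *)
Lemma star_hub m e u q D t Z : simple_rel e -> uniq (D ++ t) ->
  {in D, forall v, e q v} -> {in t, forall v, ~~ e q v} ->
  q \notin Z -> q \notin t -> {in Z, forall z, ~~ e q z} ->
  {in t, forall b, e q (u b)} ->
  {in t, forall b, {in D ++ t, forall v, e (u b) v = (v == b)}} ->
  {in t, forall b, {in Z, forall z, ~~ e (u b) z}} ->
  {in t &, forall b c, ~~ e (u b) (u c)} ->
  m <= size (D ++ t) -> hub_reachable m e (D ++ t) Z.
Proof.
elim: t e D => [|b t IH] e D hsg hu qD qt qZ qnt qz qu uv uz uu sz.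
  by rewrite cats0 in hu sz *; apply: hub_reachable_direct sz qD qZ qz.
have [se ie] := hsg; have bt : b \in b :: t by rewrite inE eqxx.
have E : rcons D b ++ t = D ++ b :: t by rewrite cat_rcons.
have sgl := simple_rel_lcomp (u b) hsg.
have ub v : v \in rcons D b ++ t -> e (u b) v = (v == b).
  by rewrite E; apply: uv.
have nb v : v \in D ++ t -> e (u b) v = false.
  move=> h; rewrite ub; last by rewrite E mem_cat inE orbCA -mem_cat h orbT.
  apply: contraTF h => /eqP->; move: hu; rewrite -cat_rcons cat_uniq rcons_uniq.
  rewrite mem_cat negb_or => /and3P[/andP[-> _] /hasPn h _] /=.
  by apply/negP => /h /=; rewrite mem_rcons inE eqxx.
apply: (@hub_reachable_lcomps _ _ [:: u b]).
  apply: (@lcomp_agree _ _ b) => x; rewrite mem_cat => /orP[h|/(uz b bt)/negbTE->//].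
  by rewrite uv // => /eqP.
have st x : x \in t -> x \in b :: t by rewrite inE orbC => ->.
rewrite -E; apply: IH => //=; rewrite ?E //.
- move=> v; rewrite mem_rcons inE => /orP[/eqP->|vD].
    rewrite /lcomp (negbTE (qt b bt)) se qu // ub; last by rewrite E mem_cat bt orbT.
    by rewrite eqxx /= andbT; apply: contraNneq qnt => ->.
  by rewrite lcomp_idr ?qD // nb // mem_cat vD.
- by move=> v vt; rewrite lcomp_idr ?qt ?st // nb // mem_cat vt orbT.
- by apply: contraNN qnt; apply: st.
- by move=> z zZ; rewrite lcomp_idr ?qz // uz.
- by move=> c /st ct; rewrite lcomp_idr ?qu // uu.
- by move=> c /st ct v vD; rewrite lcomp_idl ?uu ?uv //.
- by move=> c /st ct z zZ; rewrite lcomp_idl ?uu ?uz //.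
- by move=> c d /st ct /st dt; rewrite lcomp_idl uu.
Qed.

(** Local complementation at [q] turns a clique of neighbours into a star. *)
Lemma clique_hub m e u q t Z : simple_rel e -> uniq t ->
  {in t, forall v, ~~ e q v} ->
  q \notin Z -> q \notin t -> {in Z, forall z, ~~ e q z} ->
  {in t, forall b, e q (u b)} ->
  {in t &, forall b v, e (u b) v = (v == b)} ->
  {in t, forall b, {in Z, forall z, ~~ e (u b) z}} ->
  {in t &, forall b c, b != c -> e (u b) (u c)} ->
  m <= size t -> hub_reachable m e t Z.
Proof.
move=> hsg hu qt qZ qnt qz qu uv uz uu sz; have [se ie] := hsg.
have qq x : lcomp e q q x = e q x by rewrite lcomp_idl ?ie.
apply: (@hub_reachable_lcomps _ _ [:: q]).
  apply: (@lcomp_agree _ _ q) => x; rewrite mem_cat => /orP[/qt|/qz] /negbTE-> //.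
apply: (@star_hub m (lcomp e q) u q [::] t) => //=.
- exact: simple_rel_lcomp.
- by move=> v vt; rewrite qq qt.
- by move=> v vt; rewrite qq qz.
- by move=> v vt; rewrite qq qu.
- by move=> b bt v vt; rewrite lcomp_idr ?qt ?uv //.
- by move=> b bt v vt; rewrite lcomp_idr ?qz ?uz //.
- move=> b c bt ct; have [->|nbc] := eqVneq b c; first by rewrite /lcomp eqxx addbF ie.
  rewrite /lcomp uu // !qu // !andbT addTb negbK.
  by apply: contraTneq (uu b c bt ct nbc) => ->; rewrite ie.
Qed.

(** The vertices [u b] continue an induced path starting at the hub [q], and each
    has the private neighbour [b]. The path is consumed two vertices at a time:
    local complementations at [q] and at the next path vertex [u b] complement
    the set [D] of neighbours of the hub twice, hence leave it independent, and
    make the following path vertex [u c] the new hub, adjacent to [D] and to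
    [c]. The vertex [b] is given up, which accounts for the halving. *)
Lemma path_hub m e u q D t Z : simple_rel e -> uniq (D ++ t) ->
  {in D, forall v, e q v} -> {in t, forall v, ~~ e q v} ->
  q \notin Z -> {in Z, forall z, ~~ e q z} ->
  induced_path e (q :: map u t) -> uniq (q :: map u t) ->
  {in t, forall b, {in D ++ t, forall v, e (u b) v = (v == b)}} ->
  {in t, forall b, u b \notin Z /\ {in Z, forall z, ~~ e (u b) z}} ->
  {in D ++ t &, forall v w, ~~ e v w} ->
  m <= size D + (size t)./2 -> hub_reachable m e (D ++ t) Z.
Proof.
have [n] := ubnP (size t); elim: n t e q D => // n IH t e q D; rewrite ltnS => st hsg.
move=> hu qD qt qZ qz hp hup uv uz ind.
have small : m <= size D -> hub_reachable m e (D ++ t) Z.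
  move=> sD; apply: (@hub_reachable_sub _ _ _ D).
    by move=> x xD; rewrite mem_cat xD.
  by apply: hub_reachable_direct qD qZ qz => //; move: hu; rewrite cat_uniq => /andP[].
case: t st hu qt hp hup uv uz ind small => [|b [|c t]] st hu qt hp hup uv uz ind small.
- by rewrite addn0.
- by rewrite addn0.
clear small; rewrite /= addnS -addSn => sm.
have [se ie] := hsg.
set e1 := lcomp e q; set e2 := lcomp e1 (u b).
have bt : b \in [:: b, c & t] by rewrite inE eqxx.
have ct : c \in [:: b, c & t] by rewrite !inE eqxx orbT.
have tt x : x \in t -> x \in [:: b, c & t] by rewrite !inE => ->; rewrite !orbT.
have eqb : e q (u b) by case/andP: hp => /andP[].
have ebc : e (u b) (u c) by case/and3P: hp => _ /andP[].
have qut x : x \in c :: t -> ~~ e q (u x).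
  by move=> h; case/andP: hp => /andP[_ /allP hh] _; apply: hh; rewrite (map_f u h).
have but x : x \in t -> ~~ e (u b) (u x).
  by move=> h; case/and3P: hp => _ /andP[_ /allP hh] _; apply: hh; rewrite map_f.
have sub0 : {subset c :: D ++ t <= D ++ [:: b, c & t]}.
  by move=> x; rewrite !(inE, mem_cat) => /or3P[] ->; rewrite ?orbT.
have [nbb hu'] : b \notin c :: D ++ t /\ uniq (c :: D ++ t).
  have : perm_eq (D ++ [:: b, c & t]) (b :: c :: D ++ t).
    by rewrite perm_catC /= !perm_cons perm_catC perm_refl.
  by move/perm_uniq; rewrite hu => /esym /= /andP[-> /andP[-> ->]].
have nb v : v \in c :: D ++ t -> ~~ e (u b) v.
  move=> h; rewrite uv ?sub0 //; by apply: contraNneq nbb => <-.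
(* Among the vertices still in use, [q] has the neighbours [D] and [u b] in [e],
   and [u b] has the neighbours [D] and [u c] in [e1]. *)
have F1 x y : ~~ e q x -> ~~ e (u b) x -> e2 x y = e x y.
  by move=> h1 h2; rewrite /e2 lcomp_idl /e1; [rewrite lcomp_idl | rewrite lcomp_idr].
have F1' x y : ~~ e q y -> ~~ e (u b) y -> e2 x y = e x y.
  by move=> h1 h2; rewrite /e2 lcomp_idr /e1 ?lcomp_idr.
(* [u x] is adjacent to [x], which has no neighbours in [D ++ t]. *)
have uD x v : x \in [:: b, c & t] -> v \in D ++ [:: b, c & t] -> u x != v.
  move=> xt vD; have xa : x \in D ++ [:: b, c & t] by rewrite mem_cat xt orbT.
  have h : e (u x) x by rewrite uv ?eqxx.
  by apply: contraTneq h => ->; apply: ind.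
have e1b x : x \in D -> e1 (u b) x.
  move=> xD; rewrite /e1 /lcomp (negbTE (nb x _)) ?inE ?mem_cat ?xD ?orbT //.
  by rewrite eqb qD // uD // mem_cat xD.
have F2 : {in D &, e2 =2 e}.
  move=> x y xD yD; rewrite /e2 {1}/lcomp !e1b // /e1 /lcomp !qD // !andbT.
  by rewrite -addbA addbb addbF.
have F3 x : x \in D -> e2 (u c) x.
  move=> xD; have qc : ~~ e q (u c) by rewrite qut ?inE ?eqxx.
  have xA : x \in D ++ [:: b, c & t] by rewrite mem_cat xD.
  have E1 : e1 (u c) x = false.
    rewrite /e1 lcomp_idl // uv //; apply: contraTF xD => /eqP->.
    by move: hu'; rewrite /= mem_cat negb_or => /andP[/andP[]].
  have E2 : e1 (u b) (u c) by rewrite /e1 lcomp_idr.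
  by rewrite /e2 /lcomp E1 E2 e1b // uD.
have T1 x y : x \in c :: t -> e2 x y = e x y.
  move=> xt; have xA : x \in [:: b, c & t] by rewrite in_cons xt orbT.
  have xB : x \in c :: D ++ t.
    by move: xt; rewrite !inE mem_cat => /orP[]->; rewrite ?orbT.
  by apply: F1; [apply: qt | apply: nb].
have sg2 : simple_rel e2 by do 2!apply: simple_rel_lcomp.
have T1' x y : y \in c :: t -> e2 x y = e x y.
  move=> yt; rewrite sg2.1 T1 // se //.
have Z1 x y : y \in Z -> e2 x y = e x y.
  by move=> yZ; rewrite F1' ?qz //; case: (uz b bt) => _; apply.
have U1 x y : x \in t -> e2 (u x) y = e (u x) y.
  by move=> xt; rewrite F1 ?but ?qut // inE xt orbT.
have ctD x : x \in c :: D ++ t -> x \in c :: t \/ x \in D.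
  by rewrite !(inE, mem_cat) => /or3P[]->; rewrite ?orbT; auto.
have sub : {subset (c :: D) ++ t <= D ++ [:: b, c & t]} := sub0.
apply: (@hub_reachable_sub _ _ _ ((c :: D) ++ t)) => //.
apply: (@hub_reachable_lcomps _ _ [:: q; u b]).
  have e2Z x y : x \in Z -> e2 x y = e x y.
    by move=> xZ; rewrite sg2.1 Z1 // se.
  move=> x y; rewrite !mem_cat.
  have [yZ|_] := boolP (y \in Z); first by move=> _ _; apply: Z1.
  have [xZ|_] := boolP (x \in Z); first by move=> _ _; apply: e2Z.
  rewrite !orbF -!mem_cat => /ctD[xct _|xD]; first exact: T1.
  by case/ctD=> [yct|yD]; [apply: T1'|apply: F2].
apply: (IH t e2 (u c)) => //.
- by apply: leq_trans st; rewrite /= ltnS leqnSn.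
- move=> v; rewrite inE => /orP[/eqP->|]; last exact: F3.
  by rewrite T1' ?inE ?eqxx // uv ?eqxx // mem_cat ct orbT.
- move=> v vt; rewrite T1' ?inE ?vt ?orbT // uv ?mem_cat ?(tt _ vt) ?orbT //.
  apply: contraTneq vt => ->.
  by move: hu'; rewrite /= mem_cat negb_or => /andP[/andP[]].
- by case: (uz c ct).
- by move=> z zZ; rewrite Z1 //; case: (uz c ct) => _; apply.
- have hp3 : induced_path e (u c :: map u t) by case/and3P: hp.
  rewrite -(@eq_induced_path _ e) // => x y; rewrite !inE.
  case/predU1P => [->|/mapP[a at_ ->]] hy; last by rewrite U1.
  case/predU1P: hy => [->|/mapP[a at_ ->]]; first by rewrite sg2.2 ie.
  by rewrite sg2.1 U1 // se.
- by move: hup => /= /and3P[].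
- move=> x xt v /sub vD. rewrite U1 // uv ?tt //.
- by move=> x xt; case: (uz x (tt x xt)) => h1 h2; split=> // z zZ; rewrite Z1 ?h2.
- move=> v w vA wA; suff -> : e2 v w = e v w by apply: ind; apply: sub.
  case/ctD: vA => v1; first exact: T1.
  by case/ctD: wA => w1; [apply: T1'|apply: F2].
Qed.

End Hub.

(** * Connectivity and distances *)

Section Conn.
Variable T : finType.
Implicit Types (e : rel T) (C H U X : {set T}).

(** [H] induces a connected graph: every nontrivial cut of [H] is crossed by an
    edge. *)
Definition conn e H := [forall X : {set T},
  [&& X \subset H, X != set0 & X != H] ==>
  [exists x in X, exists y in H :\: X, e x y]].

Lemma conn_cut e H X : conn e H -> X \subset H -> X != set0 -> X != H ->
  exists x y, [/\ x \in X, y \in H, y \notin X & e x y].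
Proof.
move=> /forallP /(_ X) /implyP h h1 h2 h3.
have /exists_inP[x xX /exists_inP[y]] := h (introT and3P (And3 h1 h2 h3)).
by rewrite inE => /andP[yX yH] exy; exists x, y.
Qed.

Lemma nconn_cut e H : ~~ conn e H -> exists X, [/\ X \subset H, X != set0, X != H &
  {in X & H :\: X, forall x y, ~~ e x y}].
Proof.
rewrite negb_forall => /existsP[X]; rewrite negb_imply => /andP[/and3P[h1 h2 h3]].
rewrite negb_exists_in => /forall_inP h; exists X; split=> // x y xX yX.
by have := h x xX; rewrite negb_exists_in => /forall_inP; apply.
Qed.

(** Suppose both conclusions fail, with cuts [X] and [Y]. As [H] is connected,
    both sides of both cuts contain neighbours of [h]. Neighbours of [h] on
    different sides of [Y] are adjacent in [e], since they are not after local
    complementation, while those on different sides of [X] are not; this is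
    impossible. *)
Lemma conn_elim e H h : simple_rel e -> conn e H -> h \in H ->
  conn e (H :\ h) || conn (lcomp e h) (H :\ h).
Proof.
move=> [se ie] cH hH; apply/negPn/negP; rewrite negb_or => /andP[].
case/nconn_cut=> X [sX X0 XH nX] /nconn_cut[Y [sY Y0 YH nY]].
(* Both sides of either cut contain a neighbour of [h]. *)
have side (A : {set T}) : A \subset H :\ h -> A != set0 -> (forall y, y \in A ->
    forall z, z \in (H :\ h) :\: A -> e y z -> e h y && e h z) ->
    exists2 a, a \in A & e h a.
  move=> sA A0 hA; have [|||x [y [xA yH yA exy]]] := conn_cut (X := A) cH.
  - by apply: subset_trans sA _; apply: subD1set.
  - by [].
  - by apply: contraTneq sA => ->; apply/subsetPn; exists h; rewrite // !inE eqxx.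
  exists x => //; have [yh|yh] := eqVneq y h; first by rewrite se -yh.
  have yD : y \in (H :\ h) :\: A by rewrite !inE yh yH yA.
  by have /andP[] := hA x xA y yD exy.
have DX : (H :\ h) :\: X \subset H :\ h by apply: subsetDl.
have DY : (H :\ h) :\: Y \subset H :\ h by apply: subsetDl.
have D0 (A : {set T}) : A \subset H :\ h -> A != H :\ h -> (H :\ h) :\: A != set0.
  move=> sA; apply: contraNneq => /eqP; rewrite setD_eq0 => s2.
  by rewrite eqEsubset sA.
have DD (A : {set T}) z : A \subset H :\ h ->
    z \in (H :\ h) :\: ((H :\ h) :\: A) -> z \in A.
  by move=> sA; rewrite setDDr setDv set0U (setIidPr sA).
have YP y z : y \in Y -> z \in (H :\ h) :\: Y -> e y z -> e h y && e h z.
  by move=> yY zY eyz; have := nY y z yY zY; rewrite /lcomp eyz addTb negbK => /and3P[_ -> ->].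
have [a aX ha] : exists2 a, a \in X & e h a.
  by apply: side => // y yX z zX eyz; have := nX y z yX zX; rewrite eyz.
have [b bX hb] : exists2 b, b \in (H :\ h) :\: X & e h b.
  apply: side => //; first exact: D0.
  by move=> y yX z /(DD _ _ sX) zX; rewrite se => eyz; have := nX z y zX yX; rewrite eyz.
have [c cY hc] : exists2 c, c \in Y & e h c.
  by apply: (side Y sY Y0) => y yY z; apply: YP.
have [d dY hd] : exists2 d, d \in (H :\ h) :\: Y & e h d.
  apply: side => //; first exact: D0.
  move=> y yY z /(DD _ _ sY) zY; rewrite se => eyz.
  by have := YP _ _ zY yY eyz; rewrite andbC.
have edge y z : y \in Y -> z \in (H :\ h) :\: Y -> e h y -> e h z -> e y z.
  move=> yY zY hy hz; have := nY y z yY zY; rewrite /lcomp hy hz andbT andbT.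
  suff -> : y != z by rewrite addbT negbK.
  by apply: contraTneq zY => <-; rewrite inE yY.
have nab y z : y \in X -> z \in (H :\ h) :\: X -> e y z -> False.
  by move=> yX zX eyz; have := nX y z yX zX; rewrite eyz.
have inH y : y \in X \/ y \in Y -> y \in H :\ h.
  by case; apply: subsetP.
have inHD y (A : {set T}) : y \in (H :\ h) :\: A -> y \in H :\ h by case/setDP.
have [aY|aY] := boolP (a \in Y); have [bY|bY] := boolP (b \in Y).
- have ead := edge a d aY dY ha hd; have ebd := edge b d bY dY hb hd.
  have [dX|dX] := boolP (d \in X); first by apply: (nab d b); rewrite // se.
  by apply: (nab a d) => //; rewrite inE dX (inHD _ _ dY).
- by apply: (nab a b) => //; apply: edge => //; rewrite inE bY (inHD _ _ bX).
- by apply: (nab a b); rewrite // se; apply: edge => //; rewrite inE aY inH //; left.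
- have aY' : a \in (H :\ h) :\: Y by rewrite inE aY inH //; left.
  have bY' : b \in (H :\ h) :\: Y by rewrite inE bY (inHD _ _ bX).
  have ead := edge c a cY aY' hc ha; have ebd := edge c b cY bY' hc hb.
  have [cX|cX] := boolP (c \in X); first by apply: (nab c b).
  have cX' : c \in (H :\ h) :\: X by rewrite inE cX inH //; right.
  by apply: (nab a c); rewrite // se.
Qed.

(** Eliminating the vertices of [H] outside [U] one by one. Those have no
    neighbours in [W], so the rows of [W] never change. *)
Lemma conn_eliminate e H U (W : seq T) : simple_rel e -> conn e H -> U \subset H ->
  {in H :\: U & W, forall h w, ~~ e h w} ->
  exists xs, conn (lcomps e xs) U /\ {in W, forall w y, lcomps e xs w y = e w y}.
Proof.
have [n] := ubnP #|H :\: U|; elim: n e H => // n IH e H; rewrite ltnS => sH hsg cH sU hW.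
have [H0|/set0Pn[h hHU]] := eqVneq (H :\: U) set0.
  exists [::]; split=> //; have -> : U = H by apply/eqP; rewrite eqEsubset sU -setD_eq0 H0 eqxx.
  by [].
have /setDP[hH hU] := hHU.
have E : (H :\ h) :\: U = (H :\: U) :\ h by rewrite !setDDl setUC.
have sz : #|(H :\ h) :\: U| < n.
  by apply: leq_trans sH; rewrite E [X in _ < X](cardsD1 h) hHU.
have sU' : U \subset H :\ h by rewrite subsetD1 sU.
have sub x : x \in (H :\ h) :\: U -> x \in H :\: U by rewrite E => /setD1P[].
case/orP: (conn_elim hsg cH hH) => c1.
  have [|xs [h1 h2]] := IH e (H :\ h) sz hsg c1 sU'; last by exists xs.
  by move=> x w /sub xH wW; apply: hW.
have rowW w y : w \in W -> lcomp e h w y = e w y.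
  by move=> wW; rewrite lcomp_idl // hW.
have [|xs [h1 h2]] := IH (lcomp e h) (H :\ h) sz (simple_rel_lcomp h hsg) c1 sU'.
- by move=> x w /sub xH wW; rewrite lcomp_idr ?hW.
- by exists (h :: xs); split=> // w wW y; rewrite /= h2 // rowW.
Qed.

(** Distances from [r] in the connected set [C]. *)
Lemma dist_exists e C r : conn e C -> r \in C -> exists d : T -> nat,
  [/\ d r = 0, {in C, forall x, d x = 0 -> x = r},
    {in C, forall x, 0 < d x -> exists y, [/\ y \in C, e y x & (d y).+1 = d x]} &
    {in C &, forall x y, e x y -> d y <= (d x).+1}].
Proof.
move=> cC rC; pose step (B : {set T}) := B :|: [set y in C | [exists x in B, e x y]].
pose ball n := iter n step [set r].
have ballC n : ball n \subset C.
  elim: n => [|n IH] /=; first by rewrite sub1set.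
  by rewrite subUset IH; apply/subsetP=> x; rewrite inE => /andP[].
have ballS n : ball n \subset ball n.+1 by apply: subsetUl.
have ball_mono n k : n <= k -> ball n \subset ball k.
  by move=> /subnKC <-; elim: (k - n) => [|j IH]; rewrite ?addn0 // addnS (subset_trans IH).
have rb n : r \in ball n.
  by have /subsetP := ball_mono 0 n (leq0n n); apply; rewrite inE.
have grow n : ball n = C \/ n < #|ball n|.
  elim: n => [|n [IH|IH]]; first by right; rewrite cards1.
    left; apply/eqP; rewrite eqEsubset ballC -{1}IH; exact: ballS.
  have [E|ne] := eqVneq (ball n) C.
    left; apply/eqP; rewrite eqEsubset ballC -{1}E; exact: ballS.
  right; have [|x [y [xb yC yb exy]]] := conn_cut cC (ballC n) _ ne.
    by apply/set0Pn; exists r.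
  apply: leq_ltn_trans IH _; apply: proper_card; apply/properP; split=> //.
  by exists y => //; rewrite !inE yC; apply/orP; right; apply/exists_inP; exists x.
have full : ball #|C| = C.
  by case: (grow #|C|) => // h; have := subset_leq_card (ballC #|C|); rewrite leqNgt h.
pose d x := find (fun n => x \in ball n) (iota 0 #|C|.+1).
have dP x n : x \in C -> (x \in ball n) = (d x <= n).
  move=> xC; have hs : has (fun n => x \in ball n) (iota 0 #|C|.+1).
    by apply/hasP; exists #|C|; rewrite ?full // mem_iota /= add0n.
  have lt := hs; rewrite has_find size_iota in lt.
  apply/idP/idP => [xn|le].
    rewrite leqNgt; apply/negP => lt2; have := before_find 0 lt2.
    by rewrite nth_iota ?add0n ?xn // (ltn_trans lt2).
  have := nth_find 0 hs; rewrite nth_iota // add0n => h.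
  exact: (subsetP (ball_mono _ _ le)).
exists d; split.
- by apply/eqP; rewrite -leqn0 -dP.
- by move=> x xC dx; have := dP x 0 xC; rewrite dx leqnn inE => /eqP.
- move=> x xC dx; have := dP x (d x) xC; rewrite leqnn.
  case E : (d x) dx => [//|n] _ /=; rewrite !inE dP // E ltnn /= => /andP[_].
  case/exists_inP=> y yb eyx; have yC := subsetP (ballC n) _ yb; exists y; split=> //.
  congr _.+1; apply/eqP; rewrite eqn_leq -dP // yb leqNgt; apply/negP => lt.
  case: n E yb lt => // n E yb lt.
  have : x \in ball n.+1.
    by rewrite !inE xC; apply/orP; right; apply/exists_inP; exists y => //; rewrite dP.
  by rewrite dP // E ltnn.
- move=> x y xC yC exy; rewrite -dP //= !inE yC; apply/orP; right.
  by apply/exists_inP; exists x; rewrite ?dP.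
Qed.

Lemma geodesic e C (d : T -> nat) n x : simple_rel e ->
  {in C, forall x, 0 < d x -> exists y, [/\ y \in C, e y x & (d y).+1 = d x]} ->
  {in C &, forall x y, e x y -> d y <= (d x).+1} ->
  x \in C -> d x = n ->
  exists p, [/\ size p = n, {subset p <= C}, induced_path e (x :: p), uniq (x :: p) &
                {in p, forall y, d y < n}].
Proof.
move=> [se ie] hp he; elim: n x => [|n IH] x xC dx; first by exists [::].
have [|y [yC eyx dy]] := hp x xC; first by rewrite dx.
have [|p [p1 p2 p3 p4 p5]] := IH y yC; first by apply/eqP; rewrite -eqSS dy dx.
exists (y :: p); split=> //=.
- by rewrite p1.
- by move=> z; rewrite inE => /orP[/eqP->|/p2].
- rewrite se eyx -/(induced_path e (y :: p)) p3 andbT; apply/allP=> z zp.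
  apply/negP => exz; have := he z x (p2 z zp) xC; rewrite se => /(_ exz).
  by rewrite dx ltnS leqNgt p5.
- rewrite -/(uniq (y :: p)) p4 andbT inE negb_or; apply/andP; split.
    by apply: contraTneq eyx => ->; rewrite ie.
  by apply/negP => /p5; rewrite dx ltnNge leqnSn.
- move=> z; rewrite inE => /orP[/eqP->|/p5 /ltnW //].
  by rewrite -ltnS -dx -dy.
Qed.

Lemma card_bigcup_leq (I : finType) (A : {set I}) (F : I -> {set T}) m :
  {in A, forall i, #|F i| <= m} -> #|\bigcup_(i in A) F i| <= #|A| * m.
Proof.
move=> h; rewrite -sum_nat_const.
elim/big_rec2: _ => [|i a B iA le]; first by rewrite cards0.
by rewrite (leq_trans (leq_card_setU _ _)) // leq_add // h.
Qed.

Lemma card_dist_ball e C (d : T -> nat) r D n :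
  {in C, forall x, d x = 0 -> x = r} ->
  {in C, forall x, 0 < d x -> exists y, [/\ y \in C, e y x & (d y).+1 = d x]} ->
  {in C, forall x, #|[set y in C | e x y]| <= D} ->
  #|[set x in C | d x <= n]| <= D.+1 ^ n.
Proof.
move=> h0 hp hD; elim: n => [|n IH].
  apply: leq_trans (_ : #|[set r]| <= _); last by rewrite cards1.
  apply/subset_leq_card/subsetP => x; rewrite !inE leqn0 => /andP[xC /eqP dx].
  by rewrite (h0 x).
pose B := [set x in C | d x <= n].
apply: leq_trans (_ : #|\bigcup_(x in B) (x |: [set y in C | e x y])| <= _).
  apply/subset_leq_card/subsetP => x; rewrite inE => /andP[xC].
  rewrite leq_eqVlt => /orP[/eqP dx|dx].
    have [|y [yC eyx dy]] := hp x xC; first by rewrite dx.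
    apply/bigcupP; exists y; last by rewrite !inE xC eyx orbT.
    by rewrite inE yC /= -ltnS dy dx leqnn.
  by apply/bigcupP; exists x; rewrite !inE ?eqxx // xC.
rewrite expnSr; apply: leq_trans (_ : #|B| * D.+1 <= _); last by rewrite leq_mul2r IH orbT.
apply: card_bigcup_leq => x; rewrite inE => /andP[xC _].
by rewrite (leq_trans (leq_card_setU _ _)) // cards1 add1n ltnS hD.
Qed.

End Conn.

(** * A hub from a connected set *)

Lemma pairwise_in_neq (X : eqType) (R : rel X) t : symmetric R -> pairwise R t ->
  {in t &, forall x y, x != y -> R x y}.
Proof.
move=> sR; elim: t => //= x t IH /andP[/allP h /IH h'] y z; rewrite !inE.
case/predU1P=> [->|yt] /predU1P[->|zt]; rewrite ?eqxx // => ne; first exact: h.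
  by rewrite sR; apply: h.
exact: h'.
Qed.

Lemma subset_map (X Y : eqType) (f : X -> Y) (s : seq X) (p : seq Y) :
  {subset p <= map f s} -> exists2 t, {subset t <= s} & map f t = p.
Proof.
elim: p => [|y p IH] h; first by exists [::].
have [|t t1 t2] := IH; first by move=> x xp; apply: h; rewrite inE xp orbT.
have /mapP[x xs ->] := h y (mem_head _ _).
exists (x :: t); last by rewrite /= t2.
by move=> z; rewrite inE => /orP[/eqP->|/t1].
Qed.

(** Each [v] in [s] has a private neighbour [u v] in the connected set [H], and
    [H] has no other adjacency with [s] and [Z]. Eliminating the rest of [H]
    makes the [u v] connected; a vertex of large degree among them gives a star
    or a clique by Ramsey's theorem, and if there is none, a vertex far from a
    root gives a long induced path. *)
Lemma connected_hub m :
  {N | forall (T : finType) (e : rel T) s (u : T -> T) Z (H : {set T}),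
  simple_rel e -> uniq s -> conn e H -> {in s, forall v, u v \in H} ->
  {in H, forall h, h \notin map u s -> {in s ++ Z, forall w, ~~ e h w}} ->
  {in s &, forall b v, e (u b) v = (v == b)} ->
  {in s, forall b, u b \notin Z /\ {in Z, forall z, ~~ e (u b) z}} ->
  {in s &, forall v w, ~~ e v w} ->
  N <= size s -> hub_reachable m e s Z}.
Proof.
have [D rams] := ramsey_seq m m.
exists (D.+1 ^ m.*2).+1 => T e s u Z H hsg us cH uH hH uv uz ind sz.
set U := [set x in map u s].
have UP x : (x \in U) = (x \in map u s) by rewrite inE.
have [||xs [cU row]] := @conn_eliminate _ e H U (s ++ Z) hsg cH.
- by apply/subsetP=> x; rewrite UP => /mapP[v vs ->]; apply: uH.
- by move=> h w /setDP[h1 h2] wW; apply: hH; rewrite // -UP.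
set e' := lcomps e xs in cU row *.
have hsg' : simple_rel e' by apply: simple_rel_lcomps.
have [se ie] := hsg'.
have colW x w : w \in s ++ Z -> e' x w = e x w.
  by move=> wW; rewrite se row // hsg.1.
have inS v : v \in s -> v \in s ++ Z by rewrite mem_cat => ->.
have inZ z : z \in Z -> z \in s ++ Z by rewrite mem_cat orbC => ->.
apply: (@hub_reachable_lcomps _ _ _ xs); first by move=> x y xW yW; apply: row.
rewrite -/e'.
have {uv} uv : {in s &, forall b v, e' (u b) v = (v == b)}.
  by move=> b v bs vs; rewrite colW ?uv ?inS.
have {uz} uz : {in s, forall b, u b \notin Z /\ {in Z, forall z, ~~ e' (u b) z}}.
  by move=> b bs; have [h1 h2] := uz b bs; split=> // z zZ; rewrite colW ?h2 ?inZ.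
have {ind} ind : {in s &, forall v w, ~~ e' v w}.
  by move=> v w vs ws; rewrite colW ?inS // ind.
have us' b : b \in s -> u b \notin s.
  move=> bs; apply/negP => ubs; have := ind (u b) b ubs bs.
  by rewrite uv // eqxx.
have uinj : {in s &, injective u}.
  by move=> b c bs cs E; apply/eqP; rewrite -(uv c b) // -E uv // eqxx.
(* A vertex of large degree among the [u v]: the vertices adjacent to it contain
   a large clique or a large independent set. *)
have [/hasP[b bs hb]|hsmall] := boolP (has (fun b => D <= count (fun c => e' (u b) (u c)) s) s).
  pose l := filter (fun c => e' (u b) (u c)) s.
  have lP c : c \in l -> [/\ c \in s, e' (u b) (u c) & c != b].
    rewrite mem_filter => /andP[h cs]; split=> //.
    by apply: contraTneq h => ->; rewrite ie.
  have common t : subseq t l -> [/\ uniq t, {subset t <= s},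
      {in t, forall v, ~~ e' (u b) v}, u b \notin t & {in t, forall c, e' (u b) (u c)}].
    move=> tl; split.
    - by apply: subseq_uniq tl _; apply: filter_uniq.
    - by move=> x /(mem_subseq tl)/lP[].
    - by move=> x /(mem_subseq tl)/lP[xs' _ /negbTE]; rewrite uv // => ->.
    - apply: contraNN (us' b bs) => /(mem_subseq tl)/lP[] //.
    - by move=> x /(mem_subseq tl)/lP[].
  have [ubZ ubz] := uz b bs.
  have sl : D <= size l by rewrite size_filter.
  have [[t [tl st pw]]|[t [tl st pw]]] := rams T (fun x y => e' (u x) (u y)) l sl.
    have [t1 t2 t3 t4 t5] := common t tl; apply: (hub_reachable_sub t2).
    apply: (@clique_hub _ m e' u (u b)) => //.
    - by move=> c v ct vt; rewrite uv ?t2.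
    - by move=> c ct; case: (uz c (t2 c ct)).
    - by move=> c d ct dt; apply: (pairwise_in_neq _ pw) => // x y; rewrite /= se.
    - by rewrite st.
  have [t1 t2 t3 t4 t5] := common t tl; apply: (hub_reachable_sub t2).
  apply: (@star_hub _ m e' u (u b) [::]) => //.
  - by move=> c ct v vt; rewrite uv ?t2.
  - by move=> c ct; case: (uz c (t2 c ct)).
  - move=> c d ct dt; have [->|ne] := eqVneq c d; first by rewrite ie.
    by apply: (pairwise_in_neq _ pw) => // x y; rewrite /= se.
  - by rewrite st.
have [r rU] : exists r, r \in U.
  case: {+}s sz @U UP {cU} => // x t _ U _.
  by exists (u x); rewrite inE /= inE eqxx.
have [d [d0 dz dp de]] := dist_exists cU rU.
have [hle|/subsetPn[x xU xd]] := boolP (U \subset [set x in U | d x <= m.*2]).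
  have hD : {in U, forall x, #|[set y in U | e' x y]| <= D}.
    move=> x; rewrite UP => /mapP[b bs ->].
    have /hasPn/(_ b bs) := hsmall; rewrite -ltnNge => /ltnW; apply: leq_trans.
    rewrite -size_filter -(size_map u).
    apply: leq_trans (card_size _); apply/subset_leq_card/subsetP=> y.
    rewrite !inE => /andP[/mapP[c cs ->] h].
    by apply: map_f; rewrite mem_filter h.
  have := leq_trans (subset_leq_card hle) (card_dist_ball (m.*2) dz dp hD).
  suff -> : #|U| = size s by rewrite leqNgt sz.
  rewrite cardsE -(size_map u); apply/card_uniqP.
  by rewrite map_inj_in_uniq.
have {xd} xd : m.*2 < d x by move: xd; rewrite inE xU -ltnNge.
have [p [sp pU pp up _]] := geodesic hsg' dp de xU (erefl (d x)).
have [|[//|b t] ts E] := @subset_map _ _ u s (x :: p).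
  by move=> y; rewrite -UP inE => /orP[/eqP->|/pU].
have bs : b \in s by apply: ts; rewrite inE eqxx.
have ts' : {subset t <= s} by move=> y yt; apply: ts; rewrite inE yt orbT.
rewrite -E in pp up.
have ut : uniq (b :: t) by apply: (@map_uniq _ _ u).
have [ubZ ubz] := uz b bs.
apply: (hub_reachable_sub ts'); apply: (@path_hub _ m e' u (u b) [::] t) => //.
- by case/andP: ut.
- move=> v vt; rewrite (uv b v bs (ts' v vt)); apply: contraTneq vt => ->.
  by case/andP: ut.
- by move=> c ct v vt; rewrite (uv c v (ts' c ct) (ts' v vt)).
- by move=> c ct; apply: uz; apply: ts'.
- by move=> v w vt wt; apply: ind; apply: ts'.
- have -> : size t = d x by rewrite -sp -(size_map u); case: E => _ ->.
  by rewrite add0n -[m]doubleK half_leq // ltnW.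
Qed.

(** * Long induced paths in a distance level *)

(** A set in which every vertex but [r] has a neighbour closer to [r] is
    connected. *)
Lemma conn_parents (T : finType) (e : rel T) (H : {set T}) (d : T -> nat) r :
  symmetric e -> r \in H ->
  {in H, forall x, x != r -> exists y, [/\ y \in H, e y x & d y < d x]} ->
  conn e H.
Proof.
move=> se rH hp; apply/forallP=> X; apply/implyP=> /and3P[sX X0 XH].
have main (Y : {set T}) : Y \subset H -> Y != set0 -> r \notin Y ->
    exists x y, [/\ x \in Y, y \in H, y \notin Y & e y x].
  move=> sY /set0Pn[x0 x0Y] rY.
  case: (arg_minnP d x0Y) => x xY xmin.
  have [||y [yH eyx dy]] := hp x; first exact: (subsetP sY).
    by apply: contraNneq rY => <-.
  exists x, y; split=> //; apply: contraTN dy => /xmin; by rewrite -leqNgt.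
have [rX|rX] := boolP (r \in X).
  have [|||y [x [yD xH xD exy]]] := main (H :\: X).
  - exact: subsetDl.
  - by apply: contraNneq XH => /eqP; rewrite setD_eq0 => s2; rewrite eqEsubset sX.
  - by rewrite inE rX.
  apply/exists_inP; exists x; first by move: xD; rewrite inE xH andbT negbK.
  by apply/exists_inP; exists y.
have [x [y [xX yH yX eyx]]] := main X sX X0 rX.
apply/exists_inP; exists x => //; apply/exists_inP; exists y; last by rewrite se.
by rewrite inE yX.
Qed.

(** [d] is the distance from [r] in [C], and [P] is a long induced path in the
    level [i.+2]; [q] bounds the cliques of [C]. The vertices [v] of the
    argument lie in level [i.+1], and their parents [u] in level [i]. *)
Lemma level_fan_minor k q : {N | forall (T : finType) (e : rel T) (C : {set T})
    (d : T -> nat) r i (P : seq T), simple_rel e -> r \in C -> d r = 0 ->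
  {in C, forall x, d x = 0 -> x = r} ->
  {in C, forall x, 0 < d x -> exists y, [/\ y \in C, e y x & (d y).+1 = d x]} ->
  {in C &, forall x y, e x y -> d y <= (d x).+1} ->
  (forall t, {subset t <= C} -> pairwise e t -> size t <= q) ->
  {subset P <= C} -> {in P, forall x, d x = i.+2} -> uniq P -> induced_path e P ->
  N <= size P -> has_fan_minor k e}.
Proof.
have [Nu hup] := connected_hub k.
have [m2 ram2] := ramsey_seq k.+1 Nu.+1.
have [m1 ram1] := ramsey_seq k.+1 m2.
have [m3 ram3] := ramsey_seq q.+1 m1.
have [N hbl] := separated_blocks k m3.
exists N => T e C d r i P hsg rC dr d0 dp de hq PC Pd uP iP sP.
have [se ie] := hsg.
pose par x := odflt x [pick y in C | e y x && ((d y).+1 == d x)].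
have parP x : x \in C -> 0 < d x -> [/\ par x \in C, e (par x) x & (d (par x)).+1 = d x].
  move=> xC dx; rewrite /par; case: pickP => [y /and3P[h1 h2 /eqP h3] //|no].
  by have [y [h1 h2 h3]] := dp x xC dx; have := no y; rewrite h1 h2 h3 eqxx.
have parv x : x \in P -> [/\ par x \in C, e (par x) x & d (par x) = i.+1].
  move=> xP; have [|h1 h2] := parP x (PC x xP); first by rewrite Pd.
  by rewrite (Pd x xP) => -[].
have [/hasP[x xP hx]|hsmall] := boolP (has (fun x => k <= count (e (par x)) P) P).
  have [h1 h2 h3] := parv x xP.
  apply: (hub_fan_minor hsg _ iP hx); rewrite /= uP andbT.
  by apply/negP => /Pd; rewrite h3 => -[] /eqP; rewrite ltn_eqF.
have hpe : {in P, forall x, e (par x) x} by move=> x /parv[].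
have hcnt : {in P, forall x, count (e (par x)) P <= k}.
  by move=> x xP; have /hasPn/(_ x xP) := hsmall; rewrite -ltnNge => /ltnW.
have [pre [F [post [EP sF hF pwF]]]] := hbl T e par P sP hpe hcnt.
set Q := flatten (unzip2 F) in EP.
have QP : {subset Q <= P} by move=> x xQ; rewrite EP !mem_cat xQ orbT.
have uQ : uniq Q by move: uP; rewrite EP !cat_uniq => /and3P[_ _ /and3P[]].
have iQ : induced_path e Q by move: iP; rewrite EP => /induced_path_catr/induced_path_catl.
have Qd x : x \in Q -> d x = i.+2 by move=> /QP/Pd.
have QC x : x \in Q -> x \in C by move=> /QP/PC.
set s := unzip1 F.
have sP1 v : v \in s -> [/\ v \in C, d v = i.+1 & v \notin Q].
  case/mapP=> c cF ->; have [[x xP ->] _ _] := hF c cF.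
  have [h1 h2 h3] := parv x xP; split=> //.
  by apply/negP => /Qd; rewrite h3 => -[] /eqP; rewrite ltn_eqF.
have uv v : v \in s -> [/\ par v \in C, e (par v) v & d (par v) = i].
  move=> /sP1[h1 h2 _]; have [|g1 g2] := parP v h1; first by rewrite h2.
  by rewrite h2 => -[].
have us : uniq s.
  rewrite uniq_pairwise pairwise_map; apply: (sub_in_pairwise _ (allss F) pwF).
  move=> c c' cF c'F /andP[h _] /=; apply: contraNneq h => ->.
  by case: (hF c' c'F).
have lowQ h : h \in C -> d h <= i -> h \notin Q /\ {in Q, forall z, ~~ e h z}.
  move=> hC dh; split; first by apply/negP => /Qd E; move: dh; rewrite E ltnNge leqnSn.
  move=> z zQ; apply/negP => ehz; have := de h z hC (QC z zQ) ehz.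
  by rewrite Qd // ltnS ltnNge dh.
(* A hub for independent parents is all that is needed. *)
have fin t : {subset t <= s} -> {in t &, forall v w, ~~ e v w} ->
    hub_reachable k e t Q -> has_fan_minor k e.
  move=> ts ti [xs [h [S [[uS St kS] hS hQ hz ag]]]]; apply: (@has_fan_minor_lcomps _ _ _ xs).
  set e' := lcomps e xs in hS hz ag *.
  have inS v : v \in S -> v \in S ++ Q by rewrite mem_cat => ->.
  have inQ v : v \in Q -> v \in S ++ Q by rewrite mem_cat orbC => ->.
  have cQ c x : c \in F -> x \in c.2 -> x \in Q.
    by move=> cF xc; apply/flattenP; exists c.2 => //; apply: map_f.
  have eqc c : c \in F -> c.1 \in S -> {in c.2, e' c.1 =1 e c.1}.
    by move=> cF cS x xc; apply: ag; [apply: inS|apply: inQ; apply: (cQ c)].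
  apply: (@comb_fan_minor _ k F e' [::] h (mem S)) => //=.
  - exact: simple_rel_lcomps.
  - rewrite (@eq_induced_path _ e' e) // => x y xQ yQ; apply: ag; exact: inQ.
  - move=> c cF cS; have [_ h1 h2] := hF c cF; have eq1 := eqc c cF cS.
    have eq2 : {in c.2, e c.1 =1 e' c.1} by move=> x /eq1.
    split=> //.
    + exact: hS.
    + by case: (sP1 c.1 (map_f _ cF)).
    + by rewrite (eq_in_has eq1).
    + by rewrite (eq_in_count eq1) (eq_in_find eq1).
  - by move=> c c' cF c'F cS c'S; rewrite ag ?inS //; apply: ti; apply: St.
  - apply: (sub_in_pairwise _ (allss F) pwF) => c c' cF c'F /andP[h1 h2].
    have key a b : a \in F -> b \in F -> ~~ has (e a.1) b.2 ->
        (a.1 \in S) ==> ~~ has (e' a.1) b.2.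
      move=> aF bF hn; apply/implyP=> aS; apply: contraNN hn => /hasP[x xb hx].
      apply/hasP; exists x => //; rewrite -ag //; first exact: inS.
      by apply: inQ; apply: (cQ b).
    by rewrite /= !key.
  - rewrite add0n; apply: leq_trans kS _; rewrite -(count_map fst (mem S)) -size_filter.
    by apply: uniq_leq_size => // v vS; rewrite mem_filter /= vS; apply/ts/St.
(* The parents in level [i.+1] contain no large clique, so many are independent. *)
have [|[t [ts st pw]]|[t3 [ts3 st3 pw3]]] := ram3 T e s.
- by rewrite size_map sF.
- have := hq t _ pw; rewrite st ltnn => h; exfalso; apply: notF; apply: h.
  by move=> x /(mem_subseq ts)/sP1[].
have sub3 := mem_subseq ts3.
have ind : {in t3 &, forall v w, ~~ e v w}.
  move=> v w vt wt; have [->|ne] := eqVneq v w; first by rewrite ie.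
  by apply: (pairwise_in_neq _ pw3) => // x y; rewrite /= se.
(* A vertex of level [i] with [k] neighbours among the parents is a hub. *)
have star h t : {subset t <= t3} -> uniq t -> size t = k -> h \in C -> d h = i ->
    {in t, forall v, e h v} -> has_fan_minor k e.
  move=> tt ut st hC dh hv; have [|h1 h2] := lowQ h hC; first by rewrite dh.
  apply: (@fin t).
  - by move=> x /tt/sub3.
  - by move=> x y /tt xt /tt yt; apply: ind.
  - by apply: (@hub_reachable_direct _ _ _ h) => //; rewrite st.
have u3 : uniq t3 by apply: subseq_uniq us.
(* Either some [par v] is adjacent to all later vertices of a long subsequence,
   or no [par v] is adjacent to a later vertex. *)
have [|[t [ts st pw]]|[t1 [ts1 st1 pw1]]] := ram1 T (fun x y => e (par x) y) t3.
- by rewrite st3.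
- case: t ts st pw => // v t ts [st] /= /andP[/allP hv _].
  have vt : v \in t3 by apply: (mem_subseq ts); rewrite inE eqxx.
  have [h1 h2 h3] := uv v (sub3 v vt).
  apply: (star (par v) t) => //.
    by move=> x xt; apply: (mem_subseq ts); rewrite inE xt orbT.
  by have /andP[] := subseq_uniq ts u3.
have sub1 := mem_subseq ts1.
(* The same for the earlier vertices. *)
have [|[t [ts st pw]]|[t2 [ts2 st2 pw2]]] := ram2 T (fun x y => e (par y) x) t1.
- by rewrite st1.
- case/lastP: t ts st pw => // t v ts; rewrite size_rcons => -[st].
  rewrite pairwise_rcons => /andP[/allP hv _].
  have tt : {subset rcons t v <= t3} by move=> x /(mem_subseq ts)/sub1.
  have vt : v \in rcons t v by rewrite mem_rcons inE eqxx.
  have [h1 h2 h3] := uv v (sub3 v (tt v vt)).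
  apply: (star (par v) t) => //.
    by move=> x xt; apply: tt; rewrite mem_rcons inE xt orbT.
  by have := subseq_uniq ts (subseq_uniq ts1 u3); rewrite rcons_uniq => /andP[].
have sub2 : {subset t2 <= t3} by move=> x /(mem_subseq ts2)/sub1.
have subs : {subset t2 <= s} by move=> x /sub2/sub3.
apply: (@fin t2) => //; first by move=> x y xt yt; apply: ind; apply: sub2.
(* The vertices [par v] of level [i], together with all lower levels. *)
pose H := [set x in map par t2] :|: [set x in C | d x < i].
have HP x : x \in H -> x \in C /\ d x <= i.
  rewrite !inE => /orP[/mapP[v vt ->]|/andP[xC /ltnW] //].
  by have [h1 _ ->] := uv v (subs v vt).
have rH : r \in H.
  rewrite !inE rC dr /=; case: (posnP i) => [i0|_]; last by rewrite orbT.
  rewrite orbF.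
  have [v vt] : exists v, v \in t2.
    by case: (t2) st2 => // v t _; exists v; rewrite inE eqxx.
  have [h1 h2 h3] := uv v (subs v vt).
  by rewrite -(d0 (par v) h1) ?map_f // h3.
apply: (hup T e t2 par Q H).
- by [].
- exact: subseq_uniq (subseq_uniq ts1 u3).
- apply: (@conn_parents _ _ _ d r) => // x xH xr; have [xC dx] := HP x xH.
  have dx0 : 0 < d x by rewrite lt0n; apply: contraNneq xr => /(d0 x xC) ->.
  have [y [yC eyx dy]] := dp x xC dx0; exists y; split=> //; last by rewrite -dy.
  by rewrite !inE yC dy dx orbT.
- by move=> v vt; rewrite !inE map_f.
- move=> h hH hnot; have [hC _] := HP h hH.
  have dh : d h < i by move: hH; rewrite !inE (negbTE hnot) /= => /andP[].
  move=> w; rewrite mem_cat => /orP[wt|wQ].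
    have [wC dw _] := sP1 w (subs w wt).
    by apply/negP => ehw; have := de h w hC wC ehw; rewrite dw ltnS leqNgt dh.
  by have [_] := lowQ h hC (ltnW dh); apply.
- move=> b v bt vt; have [h1 h2 h3] := uv b (subs b bt).
  have [->|ne] := eqVneq v b; first by rewrite h2.
  have pw12 : pairwise (fun x y => ~~ e (par x) y && ~~ e (par y) x) t2.
    rewrite -[pairwise _ _]/(pairwise [rel x y | ~~ e (par x) y && ~~ e (par y) x] t2).
    rewrite (pairwise_relI (fun x y => ~~ e (par x) y) (fun x y => ~~ e (par y) x)).
    by rewrite pw2 andbT; apply: subseq_pairwise pw1.
  have sy : symmetric (fun x y => ~~ e (par x) y && ~~ e (par y) x).
    by move=> x y; rewrite andbC.
  have := pairwise_in_neq sy pw12 vt bt ne.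
  by case/andP=> _ /negbTE.
- move=> b bt; have [h1 h2 h3] := uv b (subs b bt).
  by apply: lowQ => //; rewrite h3.
- by move=> x y xt yt; apply: ind; apply: sub2.
- by rewrite st2 leqnSn.
Qed.

(** * Colourings *)

Section Col.
Variables (T : finType) (e : rel T).
Implicit Types (A B C K : {set T}).

(** The subgraph induced on [A] is [n]-colourable. The type ['I_n.+1] of colours
    is inhabited even for [n = 0]; the colours on [A] are below [n]. *)
Definition set_colorable A n := [exists c : {ffun T -> 'I_n.+1},
  [forall x in A, (c x < n) && [forall y in A, e x y ==> (c x != c y)]]].

(** A proper colouring of [A] by natural numbers below [n]. *)
Definition is_coloring (c : T -> nat) A n :=
  {in A, forall x, c x < n} /\ {in A &, forall x y, e x y -> c x <> c y}.

Lemma set_colorable_coloring A n :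
  set_colorable A n -> {c : T -> nat | is_coloring c A n}.
Proof.
move=> /existsP/sigW[c /forall_inP h]; exists (fun x => nat_of_ord (c x)).
split=> [x /h /andP[] //|x y /h /andP[_ /forall_inP h'] /h' /implyP h2 /h2].
by move=> /eqP ne E; apply: ne; apply: val_inj.
Qed.

Lemma coloring_set_colorable A n c : is_coloring c A n -> set_colorable A n.
Proof.
move=> [h1 h2]; apply/existsP; exists [ffun x => inord (c x)].
have E x : x \in A -> nat_of_ord ([ffun x => inord (c x)] x : 'I_n.+1) = c x.
  by move=> xA; rewrite ffunE inordK // ltnS ltnW // h1.
apply/forall_inP=> x xA; rewrite E // h1 //=; apply/forall_inP=> y yA.
by apply/implyP=> exy; rewrite -val_eqE /= !E //; apply/eqP/h2.
Qed.

Lemma set_colorable_mono A B m n :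
  A \subset B -> m <= n -> set_colorable B m -> set_colorable A n.
Proof.
move=> /subsetP sAB mn /set_colorable_coloring[c [h1 h2]]; apply: (@coloring_set_colorable _ _ c).
split=> [x /sAB/h1 h|x y /sAB xB /sAB yB]; last exact: h2.
exact: leq_trans h mn.
Qed.

Lemma set_colorable0 n : set_colorable set0 n.
Proof. by apply: (@coloring_set_colorable _ _ (fun=> 0)); split=> x; rewrite inE. Qed.

Lemma set_colorableU A B m n :
  set_colorable A m -> set_colorable B n -> set_colorable (A :|: B) (m + n).
Proof.
move=> /set_colorable_coloring[a [a1 a2]] /set_colorable_coloring[b [b1 b2]].
apply: (@coloring_set_colorable _ _ (fun x => if x \in A then a x else m + b x)).
have inB x : x \in A :|: B -> x \notin A -> x \in B by rewrite inE => /orP[->|].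
split=> [x xAB|x y xAB yAB exy].
  case: ifPn => xA; first by apply: leq_trans (a1 x xA) _; apply: leq_addr.
  by rewrite ltn_add2l b1 // inB.
case: ifPn => xA; case: ifPn => yA; first exact: a2.
- by move=> E; have := a1 x xA; rewrite E ltnNge leq_addr.
- by move=> E; have := a1 y yA; rewrite -E ltnNge leq_addr.
- by move/addnI; apply: b2; rewrite ?inB.
Qed.

Lemma set_colorableU_disj A B n :
  {in A & B, forall x y, ~~ e x y /\ ~~ e y x} ->
  set_colorable A n -> set_colorable B n -> set_colorable (A :|: B) n.
Proof.
move=> dis /set_colorable_coloring[a [a1 a2]] /set_colorable_coloring[b [b1 b2]].
apply: (@coloring_set_colorable _ _ (fun x => if x \in A then a x else b x)).
have inB x : x \in A :|: B -> x \notin A -> x \in B by rewrite inE => /orP[->|].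
split=> [x xAB|x y xAB yAB exy].
  by case: ifPn => xA; [apply: a1 | apply: b1; rewrite inB].
case: ifPn => xA; case: ifPn => yA; first exact: a2.
- by have [] := dis x y xA (inB _ yAB yA); rewrite exy.
- by have [_] := dis y x yA (inB _ xAB xA); rewrite exy.
- by apply: b2; rewrite ?inB.
Qed.

(** A minimal closed part of [A] that is not [n]-colourable is connected. *)
Lemma chromatic_component A n : simple_rel e -> ~~ set_colorable A n -> exists C,
  [/\ C \subset A, ~~ set_colorable C n, conn e C & {in C & A :\: C, forall x y, ~~ e x y}].
Proof.
move=> [se ie] nA.
pose P (C : {set T}) := [&& C \subset A, ~~ set_colorable C n &
  [forall x in C, forall y in A :\: C, ~~ e x y]].
have PE C : P C ->
    [/\ C \subset A, ~~ set_colorable C n & {in C & A :\: C, forall x y, ~~ e x y}].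
  move=> /and3P[h1 h2 /forall_inP h3]; split=> // x y xC yC.
  by have /forall_inP := h3 x xC; apply.
have [|C /minsetP[/PE[sC nC clC] minC]] := @ex_minset _ P.
  exists A; rewrite /P subxx nA; apply/forall_inP=> x _; apply/forall_inP=> y.
  by rewrite setDv inE.
exists C; split=> //; apply/negPn/negP => /nconn_cut[X [sX X0 XC nX]].
have small (Y : {set T}) : Y \subset C -> Y != C ->
    {in Y & C :\: Y, forall x y, ~~ e x y} -> set_colorable Y n.
  move=> sY nY hY; apply: contraNT nY => ncY; apply/eqP/minC => //.
  apply/and3P; split=> //; first exact: subset_trans sY sC.
  apply/forall_inP=> x xY; apply/forall_inP=> y /setDP[yA yY].
  have [yC|yC] := boolP (y \in C); first by apply: hY; rewrite // inE yY.
  by apply: clC; rewrite ?(subsetP sY) // inE yC.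
have sD : C :\: X \subset C by apply: subsetDl.
have cX : set_colorable X n by apply: small.
have cD : set_colorable (C :\: X) n.
  apply: small => //.
    apply: contraNneq X0 => E; rewrite -subset0; apply/subsetP=> x xX.
    by have := subsetP sX x xX; rewrite -E inE xX.
  by move=> x y xD; rewrite setDDr setDv set0U (setIidPr sX) se => yX; apply: nX.
move/negP: nC; apply; have -> : C = X :|: (C :\: X).
  by rewrite setDE setUIr setUCr setIT (setUidPr sX).
by apply: set_colorableU_disj => // x y xX yD; rewrite (se y x) nX.
Qed.

(** Gyarfas' path argument: removing the neighbours of [x] from [K] costs at most
    [c] colours, and the path goes on in a component of the rest. *)
Lemma gyarfas_path A c n x K : simple_rel e ->
  {in A, forall x, set_colorable [set y in A | e x y] c} ->
  conn e K -> x \in A -> K \subset A -> x \notin K -> (exists2 y, y \in K & e x y) ->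
  ~~ set_colorable K (n * c) ->
  exists s, [/\ size s = n, {subset s <= K}, uniq (x :: s) & induced_path e (x :: s)].
Proof.
move=> hsg hA; have [se ie] := hsg.
elim: n x K => [|n IH] x K cK xA sK xK [y0 y0K exy0] nK; first by exists [::].
set Nx := [set y in A | e x y].
have nD : ~~ set_colorable (K :\: Nx) (n * c).
  apply: contraNN nK => h; rewrite mulSn.
  apply: set_colorable_mono (set_colorableU (hA x xA) h) => //.
  by apply/subsetP=> y yK; rewrite !inE yK andbT; case: (_ && _).
have [C [sC nC cC clC]] := chromatic_component hsg nD.
have sCK : C \subset K by apply: subset_trans sC (subsetDl _ _).
have CNx y : y \in C -> ~~ e x y.
  move=> yC; have /setDP[yK] := subsetP sC y yC.
  by rewrite inE (subsetP sK).
have C0 : C != set0 by apply: contraNneq nC => ->; apply: set_colorable0.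
have CK : C != K by apply: contraTneq exy0 => E; apply: CNx; rewrite E.
have [a [y [aC yK yC eay]]] := conn_cut cK sCK C0 CK.
have exy : e x y.
  have [//|nxy] := boolP (e x y); suff : ~~ e a y by rewrite eay.
  by apply: clC => //; rewrite !inE yC yK (negbTE nxy) andbF.
have yA := subsetP sK y yK.
have yC' : exists2 b, b \in C & e y b by exists a; rewrite // se.
have [s [s1 s2 s3 s4]] := IH y C cC yA (subset_trans sCK sK) yC yC' nC.
exists (y :: s); split.
- by rewrite /= s1.
- by move=> z; rewrite inE => /orP[/eqP->//|/s2]; apply: subsetP.
- rewrite cons_uniq s3 andbT inE negb_or; apply/andP; split.
    by apply: contraNneq xK => ->.
  by apply: contraNN xK => /s2; apply: subsetP.
- rewrite /= exy -/(induced_path e (y :: s)) s4 andbT.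
  by apply/allP=> z /s2; apply: CNx.
Qed.

(** The palettes of even and odd levels are disjoint. *)
Lemma set_colorable_levels C (d : T -> nat) M : symmetric e ->
  {in C &, forall x y, e x y -> d y <= (d x).+1} ->
  (forall i, set_colorable [set x in C | d x == i] M) -> set_colorable C (M + M).
Proof.
move=> se de h; pose f i := sval (set_colorable_coloring (h i)).
have fP i : is_coloring (f i) [set x in C | d x == i] M.
  by apply: svalP (set_colorable_coloring (h i)).
have fM x : x \in C -> f (d x) x < M.
  by move=> xC; case: (fP (d x)) => h1 _; apply: h1; rewrite inE xC /=.
apply: (@coloring_set_colorable _ _ (fun x => f (d x) x + odd (d x) * M)).
split=> [x xC|x y xC yC exy].
  by case: odd; rewrite ?mul1n ?mul0n ?addn0 ?ltn_add2r ?ltn_addl ?fM.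
have [E|ne] := eqVneq (d x) (d y).
  rewrite E => /addIn; case: (fP (d y)) => _ h2; apply: h2 => //.
    by rewrite inE xC E /=.
  by rewrite inE yC /=.
have hx := fM x xC; have hy := fM y yC.
have : odd (d x) != odd (d y).
  have h1 := de x y xC yC exy; have h2 := de y x yC xC; rewrite se in h2.
  move/(_ exy): h2; rewrite leq_eqVlt => /orP[/eqP->|]; first by rewrite /=; case: odd.
  rewrite ltnS leq_eqVlt (negbTE ne) /= => lt.
  have -> : d y = (d x).+1 by apply/eqP; rewrite eqn_leq h1.
  by rewrite /=; case: odd.
case: (odd (d x)); case: (odd (d y)) => //= _; rewrite mul1n mul0n addn0 => E.
  by move: hy; rewrite -E ltnNge leq_addl.
by move: hx; rewrite E ltnNge leq_addl.
Qed.

End Col.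

(** Without a fan vertex-minor, graphs of clique number at most [q] have bounded
    chromatic number. *)
Lemma fan_minor_free_set_colorable k q :
  {c | forall (T : finType) (e : rel T) (A : {set T}), simple_rel e ->
  (forall t, {subset t <= A} -> pairwise e t -> size t <= q) ->
  ~~ set_colorable e A c -> has_fan_minor k e}.
Proof.
elim: q => [|q [c IH]].
  exists 0 => T e A _ hA; have -> : A = set0; last by rewrite set_colorable0.
  apply/setP=> x; rewrite inE; apply/negbTE/negP => xA.
  by suff: size [:: x] <= 0 by []; apply: hA => // y; rewrite inE => /eqP->.
have [N hN] := level_fan_minor k q.+1.
pose M := N * c + c + 1; exists (M + M) => T e A hsg hA nA.
have [se ie] := hsg.
have [/forall_inP hc|] :=
  boolP [forall x in A, set_colorable e [set y in A | e x y] c]; last first.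
  rewrite negb_forall_in => /exists_inP[x xA nx].
  apply: IH nx => // t tN pt; rewrite -ltnS.
  apply: (hA (x :: t)) => /=.
    by move=> y; rewrite inE => /orP[/eqP->//|/tN]; rewrite inE => /andP[].
  by rewrite pt andbT; apply/allP=> y /tN; rewrite inE => /andP[].
have [C [sC nC cC _]] := chromatic_component hsg nA.
have [r rC] : exists r, r \in C.
  by apply/set0Pn; apply: contraNneq nC => ->; apply: set_colorable0.
have [d [dr d0 dp de]] := dist_exists cC rC.
pose L i := [set x in C | d x == i].
have [i nL] : exists i, ~~ set_colorable e (L i) M.
  have [/forallP h|] :=
    boolP [forall i : 'I_(\max_(x in C) d x).+1, set_colorable e (L i) M]; last first.
    by rewrite negb_forall => /existsP[i]; exists (nat_of_ord i).
  case/negP: nC; apply: (set_colorable_levels se de) => i.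
  have [lt|ge] := ltnP i (\max_(x in C) d x).+1; first exact: (h (Ordinal lt)).
  suff -> : [set x in C | d x == i] = set0 by apply: set_colorable0.
  apply/setP=> x; rewrite !inE; apply/negbTE/negP => /andP[xC /eqP dx].
  by move: ge; rewrite -dx ltnNge leq_bigmax_cond.
(* Levels 0 and 1 are a single vertex and part of a neighbourhood. *)
have cM : c <= M by rewrite /M -addnA addnCA leq_addr.
have Lne : exists x, x \in L i.
  by apply/set0Pn; apply: contraNneq nL => ->; apply: set_colorable0.
have [j ij] : exists j, i = j.+2.
  case: i nL {Lne} => [|[|j]] nL; last by exists j.
    case/negP: nL; apply: (@coloring_set_colorable _ _ _ _ (fun=> 0)); split.
      by move=> x _; rewrite /M addn1.
    move=> x y; rewrite !inE => /andP[xC /eqP dx] /andP[yC /eqP dy].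
    by rewrite (d0 x) // (d0 y) // ie.
  case/negP: nL; apply: set_colorable_mono cM (hc r (subsetP sC r rC)).
  apply/subsetP=> x; rewrite !inE => /andP[xC /eqP dx].
  have [|y [yC eyx dy]] := dp x xC; first by rewrite dx.
  rewrite (subsetP sC) // -(d0 y) //; by apply/eqP; rewrite -eqSS dy dx.
have [K [sK nK cK _]] := chromatic_component hsg nL.
have [x xK] : exists x, x \in K.
  by apply/set0Pn; apply: contraNneq nK => ->; apply: set_colorable0.
have KL y : y \in K -> y \in C /\ d y = j.+2.
  by move=> /(subsetP sK); rewrite inE ij => /andP[yC /eqP].
have [xC dx] := KL x xK.
have [|v [vC evx dv]] := dp x xC; first by rewrite dx.
have [||||s [s1 s2 s3 s4]] := @gyarfas_path _ e A c N v K hsg hc cK (subsetP sC v vC).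
- by apply: subset_trans sC; apply/subsetP=> y /KL[].
- by apply/negP => /KL[_ E]; move: dv; rewrite E dx => /eqP; rewrite eqn_leq ltnn.
- by exists x.
- apply: contraNN nK; apply: set_colorable_mono => //; by rewrite /M -addnA leq_addr.
apply: (hN T e C d r j s) => //.
- by move=> t tC; apply: hA => y /tC; apply: subsetP.
- by move=> y /s2/KL[].
- by move=> y /s2/KL[].
- by case/andP: s3.
- by case/andP: s4.
- by rewrite s1.
Qed.

(** * Vertex-minors and the chromatic bound *)

Lemma vertex_minor_eta (G : sgraph) :
  vertex_minor G (SGraph (@edge_sym G) (@edge_irrefl G)).
Proof. by case: G => *; apply: vertex_minor_refl. Qed.

Lemma has_fan_minor_vertex_minor k (T : finType) (e : rel T) : has_fan_minor k e ->
  forall (G : sgraph) (se : symmetric e) (ie : irreflexive e),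
  vertex_minor G (SGraph se ie) ->
  exists H : sgraph, vertex_minor G H /\ contains_fan k (@edge H).
Proof.
case=> xs; elim: xs e => [|x xs IH] e /= hf G se ie vm; first by exists (SGraph se ie).
apply: (IH (lcomp e x) hf G (@local_compl_edge_sym (SGraph se ie) x)
              (@local_compl_edge_irrefl (SGraph se ie) x)).
exact: (@vertex_minor_local_compl G (SGraph se ie) x).
Qed.

(** Deleting the vertices outside the image of an embedding one at a time. *)
Lemma embedded_vertex_minor (G H F : sgraph) (f : F -> H) : vertex_minor G H ->
  injective f -> (forall x y, edge (f x) (f y) = edge x y) ->
  exists2 H', vertex_minor G H' & isomorphic H' F.
Proof.
have [n] := ubnP #|H|; elim: n H f => // n IH H f; rewrite ltnS => sH vm fi fe.
have [/forallP fs|] := boolP [forall v, v \in codom f]; last first.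
  rewrite negb_forall => /existsP[v vf].
  have fv x : f x \in [set~ v].
    by rewrite !inE; apply: contraNneq vf => <-; apply: codom_f.
  apply: (IH (delete_vertex v) (fun x => exist _ (f x) (fv x))).
  - apply: leq_trans sH; rewrite card_sig (@eq_card _ _ (mem [set~ v])) //.
    by rewrite cardsC1 ltn_predL; apply/card_gt0P; exists v.
  - exact: vertex_minor_delete.
  - by move=> x y [] /fi.
  - by move=> x y; apply: fe.
exists H => //.
pose g y := iinv (fs y).
have gK : cancel g f by move=> y; apply: f_iinv.
have fK : cancel f g by move=> x; apply: fi; rewrite gK.
exists g; first by exists f.
by move=> x y; rewrite -fe !gK.
Qed.

Lemma contains_fan_embedding k (H : sgraph) : contains_fan k (@edge H) ->
  exists2 f : fan k -> H, injective f & forall x y, edge (f x) (f y) = edge x y.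
Proof.
move=> [h [p [sp /andP[hp up] ip /allP hall]]].
pose f (x : fan k) : H := if x is Some i then nth h p i else h.
have sz (i : 'I_k) : i < size p by rewrite sp.
have pin (i : 'I_k) : nth h p i \in p by apply: mem_nth.
have fE x y : edge (f x) (f y) = edge x y.
  case: x y => [i|] [j|] /=.
  - have [lt|gt|E] := ltngtP i j.
    + by rewrite (induced_path_nth h ip) // (gtn_eqF (ltnW lt : i < j.+1)) orbF.
    + rewrite edge_sym (induced_path_nth h ip) // orbC.
      by rewrite (gtn_eqF (ltnW gt : j < i.+1)) orbF.
    + by rewrite E edge_irrefl orbb gtn_eqF.
  - by rewrite edge_sym hall.
  - by rewrite hall.
  - by rewrite edge_irrefl.
exists f => //.
case=> [i|] [j|] //= E.
- by congr Some; apply/val_inj/eqP; rewrite -(nth_uniq h (sz i) (sz j) up) E.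
- by move: hp; rewrite -E pin.
- by move: hp; rewrite E pin.
Qed.

Theorem theorem3p1 (k : nat) (k_gt0 : 0 < k) :
  chi_bounded (fan_vertex_minor_free k).
Proof.
exists (fun q => sval (fan_minor_free_set_colorable k q)) => G hG A.
set q := omega (induced A).
case: (fan_minor_free_set_colorable k q) => c hc /=.
have cA : set_colorable (@edge G) A c.
  apply: contraT => nA; exfalso; apply: hG.
  have [||] := @has_fan_minor_vertex_minor k G (@edge G) _ G (@edge_sym G) (@edge_irrefl G).
  - apply: (hc G (@edge G) A) => //; first by split; [apply: edge_sym|apply: edge_irrefl].
    move=> t tA pt.
    have ut : uniq t.
      rewrite uniq_pairwise; apply: sub_pairwise pt => x y exy /=.
      by apply: contraTneq exy => ->; rewrite edge_irrefl.
    pose B := [set x : induced A | val x \in t].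
    have cB : clique B.
      apply/forall_inP=> x; rewrite inE => xt; apply/forall_inP=> y; rewrite inE => yt.
      by apply/implyP=> ne; apply: (pairwise_in_neq (@edge_sym G) pt).
    apply: leq_trans (leq_bigmax_cond _ cB).
    apply: leq_trans (leq_imset_card val B); rewrite -(card_uniqP ut).
    apply/subset_leq_card/subsetP=> x xt; apply/imsetP.
    by exists (exist _ x (tA x xt)); rewrite ?inE.
  - exact: vertex_minor_eta.
  move=> H [vm /contains_fan_embedding[f fi fe]]; exact: embedded_vertex_minor fi fe.
have [f [f1 f2]] := set_colorable_coloring cA.
rewrite /chi; case: ex_minnP => n _; apply.
apply/existsP; exists [ffun x : induced A => Ordinal (f1 (val x) (valP x))].
apply/forallP=> x; apply/forallP=> y; apply/implyP=> exy; rewrite !ffunE -val_eqE /=.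
by apply/eqP; apply: f2 => //; apply: valP.
Qed.
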